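(* Let $\beta>1$ be rational, and let $F(X,Y),G(X,Y)\in\mathbb{R}[X,Y]$ be $\beta$-quasihomogeneous polynomials of degree $d\geq 1$, with height functions $f_+,f_-$ and $g_+,g_-$ respectively. Let $V(F)\subset\mathbb{R}^2$ be the zero set of $F$, and suppose that $V(F)\cap\{x>0\}\neq\varnothing$ and $V(F)\cap\{x<0\}\neq\varnothing$. If $F$ and $G$ are $\mathcal{R}$-semialgebraically Lipschitz equivalent, then $$\text{either}\quad f_+\cong g_+ \text{ and } f_-\cong g_-,\qquad\text{or}\quad f_+\cong g_- \text{ and } f_-\cong g_+.$$ More precisely, if $\Phi:(\mathbb{R}^2,0)\to(\mathbb{R}^2,0)$ is a germ of semialgebraic bi-Lipschitz homeomorphism with $G\circ\Phi=F$, then the first alternative holds if $\Phi$ is direct, and the second alternative holds if $\Phi$ is reverse.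
   Context: A nonzero polynomial $F\in\mathbb{R}[X,Y]$ is $\beta$-quasihomogeneous of degree $d$ ($d\ge1$ an integer) if $F(tX,t^\beta Y)=t^dF(X,Y)$ for all $t>0$. Its right and left height functions are the polynomial functions $f_+(t)=F(1,t)$ and $f_-(t)=F(-1,t)$ on $\mathbb{R}$. Two $\beta$-quasihomogeneous polynomials $F,G$ of degree $d$ are $\mathcal{R}$-semialgebraically Lipschitz equivalent if there exists a germ of semialgebraic bi-Lipschitz homeomorphism $\Phi:(\mathbb{R}^2,0)\to(\mathbb{R}^2,0)$ such that $G\circ\Phi=F$. Two nonzero polynomial functions $f,g:\mathbb{R}\to\mathbb{R}$ are Lipschitz equivalent, written $f\cong g$, if there exist a bi-Lipschitz homeomorphism $\phi:\mathbb{R}\to\mathbb{R}$ and a constant $c>0$ such that $g\circ\phi=cf$. A germ of semialgebraic bi-Lipschitz map $\Phi=(\Phi_1,\Phi_2):(\mathbb{R}^2,0)\to(\mathbb{R}^2,0)$ is a $\beta$-isomorphism of degree $d$ if there exist $\beta$-quasihomogeneous polynomials $F,G$ of degree $d$ with $G\circ\Phi=F$, and $\lim_{x\to0^+}\Phi_1(x,0)/x\neq0$, $\lim_{x\to0^-}\Phi_1(x,0)/x\neq0$. A $\beta$-isomorphism $\Phi$ is direct if $\lim_{x\to0^+}\Phi_1(x,0)/x>0$ and $\lim_{x\to0^-}\Phi_1(x,0)/x>0$; it is reverse if both of these limits are $<0$. *)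

(* Defs.v *)
From HB Require Import structures.
From mathcomp Require Import all_boot all_order all_algebra.
From mathcomp Require Import ordered_qelim.
From mathcomp Require Import all_classical all_reals all_analysis.

Set Implicit Arguments.
Unset Strict Implicit.
Unset Printing Implicit Defensive.

Import Order.TTheory GRing.Theory Num.Theory.
Import numFieldNormedType.Exports.

Local Open Scope classical_set_scope.
Local Open Scope ring_scope.

(* R[X, Y] is {poly {poly R}}, with Y the outer and X the inner variable. *)
Definition eval2 (R : realType) (F : {poly {poly R}}) (p : R * R) : R :=
  F.[p.2%:P].[p.1].

Definition quasihomogeneous (R : realType) (beta : rat) (d : nat)
    (F : {poly {poly R}}) : Prop :=
  F != 0 /\
  forall t x y : R, 0 < t ->
    eval2 F (t * x, t `^ ratr beta * y) = t ^+ d * eval2 F (x, y).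

Definition height_right (R : realType) (F : {poly {poly R}}) : {poly R} :=
  map_poly (horner_eval 1) F.

Definition height_left (R : realType) (F : {poly {poly R}}) : {poly R} :=
  map_poly (horner_eval (-1)) F.

Lemma height_rightE (R : realType) (F : {poly {poly R}}) (t : R) :
  (height_right F).[t] = eval2 F (1, t).
Proof.
have := horner_map (horner_eval 1) F t%:P.
by rewrite /= !horner_evalE hornerC.
Qed.

Lemma height_leftE (R : realType) (F : {poly {poly R}}) (t : R) :
  (height_left F).[t] = eval2 F (-1, t).
Proof.
have := horner_map (horner_eval (-1)) F t%:P.
by rewrite /= !horner_evalE hornerC.
Qed.

Definition zero_set (R : realType) (F : {poly {poly R}}) : set (R * R) :=
  [set p | eval2 F p = 0].

(* Boolean combinations of polynomial equations and inequalities in n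
   variables with coefficients in R; [rformula] excludes inverses from the
   terms, and variables of index >= n are evaluated at 0. *)
Definition semialgebraic (R : realType) (n : nat) (A : set (n.-tuple R)) : Prop :=
  exists f : ord.formula R,
    [/\ ord.qf_form f, ord.rformula f & forall e, A e <-> ord.holds e f].

Definition semialgebraic_on (R : realType) (U : set (R * R))
    (Phi : R * R -> R * R) : Prop :=
  semialgebraic [set e : 4.-tuple R |
    U (e`_0, e`_1) /\ Phi (e`_0, e`_1) = (e`_2, e`_3)].

(* Both maps being Lipschitz, f is in particular a homeomorphism of A onto B.
   On R * R the norm is the maximum norm, which defines the same bi-Lipschitz
   maps as the Euclidean norm. *)
Definition bilipschitz_homeo (R : realType) (V W : normedModType R)
    (A : set V) (B : set W) (f : V -> W) : Prop :=
  exists g : W -> V,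
    [/\ (forall x, A x -> B (f x) /\ g (f x) = x),
        (forall y, B y -> A (g y) /\ f (g y) = y),
        [lipschitz f x | x in A] & [lipschitz g y | y in B]].

(* Germs at the origin are given by representatives, total functions of which
   only the restriction to some neighborhood of the origin matters. *)
Definition sa_bilipschitz_germ (R : realType) (Phi : R * R -> R * R) : Prop :=
  Phi (0, 0) = (0, 0) /\
  exists U : set (R * R),
    [/\ open U, U (0, 0), semialgebraic_on U Phi &
        bilipschitz_homeo U (Phi @` U) Phi].

Definition sa_bilipschitz_homeo_germ (R : realType)
    (Phi : R * R -> R * R) : Prop :=
  Phi (0, 0) = (0, 0) /\
  exists U V : set (R * R),
    [/\ open U /\ U (0, 0), open V /\ V (0, 0), semialgebraic_on U Phi &
        bilipschitz_homeo U V Phi].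

(* G \o Phi = F as germs at the origin. *)
Definition germ_pullback (R : realType) (F G : {poly {poly R}})
    (Phi : R * R -> R * R) : Prop :=
  \forall p \near nbhs ((0, 0) : R * R), eval2 G (Phi p) = eval2 F p.

Definition R_sa_lipschitz_equiv (R : realType) (F G : {poly {poly R}}) : Prop :=
  exists Phi : R * R -> R * R,
    sa_bilipschitz_homeo_germ Phi /\ germ_pullback F G Phi.

Definition lipschitz_equiv (R : realType) (f g : {poly R}) : Prop :=
  [/\ f != 0, g != 0 &
      exists (phi : R -> R) (c : R),
        [/\ bilipschitz_homeo [set: R] [set: R] phi, 0 < c &
            forall t, g.[phi t] = c * f.[t]]].

Definition right_slope (R : realType) (Phi : R * R -> R * R) (l : R) : Prop :=
  (Phi (x, 0)).1 / x @[x --> 0^'+] --> l.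

Definition left_slope (R : realType) (Phi : R * R -> R * R) (l : R) : Prop :=
  (Phi (x, 0)).1 / x @[x --> 0^'-] --> l.

Definition beta_isomorphism (R : realType) (beta : rat) (d : nat)
    (Phi : R * R -> R * R) : Prop :=
  [/\ sa_bilipschitz_germ Phi,
      exists F G : {poly {poly R}},
        [/\ quasihomogeneous beta d F, quasihomogeneous beta d G &
            germ_pullback F G Phi],
      exists2 l, right_slope Phi l & l != 0 &
      exists2 l, left_slope Phi l & l != 0].

Definition direct_isomorphism (R : realType) (beta : rat) (d : nat)
    (Phi : R * R -> R * R) : Prop :=
  [/\ beta_isomorphism beta d Phi,
      exists2 l, right_slope Phi l & 0 < l &
      exists2 l, left_slope Phi l & 0 < l].

Definition reverse_isomorphism (R : realType) (beta : rat) (d : nat)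
    (Phi : R * R -> R * R) : Prop :=
  [/\ beta_isomorphism beta d Phi,
      exists2 l, right_slope Phi l & l < 0 &
      exists2 l, left_slope Phi l & l < 0].

(* Main.v *)
Require Import Defs.
From HB Require Import structures.
From mathcomp Require Import all_boot all_order all_algebra.
From mathcomp Require Import all_classical all_reals all_analysis.
From mathcomp Require Import lra.

Set Implicit Arguments.
Unset Strict Implicit.
Unset Printing Implicit Defensive.

Import Order.TTheory GRing.Theory Num.Theory.
Import numFieldNormedType.Exports.

Local Open Scope classical_set_scope.
Local Open Scope ring_scope.

(** Why the theorem holds.  Write f_s for the height of F on the side s = 1 or
    s = -1, so that F (s x, y) = x ^ d f_s (y / x ^ beta) for x > 0, and let x
    tend to 0 along an ultrafilter: every bounded function of x then has a
    limit.  In particular, blowing a bi-Lipschitz germ Phi up around moving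
    points p and q, by which we mean passing to the limit in
    v |-> (Phi (p + h v) - q) / h with h -> 0 and |Phi p - q| = O(h), yields a
    Lipschitz map of the plane whose inverse is the blow-up of the inverse germ
    [blowup].

    Take p = (s x, 0), h = x ^ beta, and suppose that Phi_1 (s x, 0) / x tends
    to l <> 0.  The zeros of G off the y-axis satisfy |y| <= M |x| ^ beta, so a
    root of f_s keeps Phi (s x, 0) at distance O(h) from the x-axis and the
    blow-up A exists with q on that axis.  In the limit, G o Phi = F reads
    f_s (t) = |l| ^ d g (A_2 (X, t) / |l| ^ beta), where g is the height of G on
    the side of the sign of l.  For fixed t the continuous function
    X |-> A_2 (X, t) stays in a level set of the nonconstant polynomial g, hence
    is constant; the same holds for the inverse of A.  So A_2 (0, _) is a
    bi-Lipschitz homeomorphism of the line, and f_s is equivalent to g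
    [heights_lipschitz_equiv].  When Phi is direct or reverse, this settles both
    sides.

    For a general Phi, let A be the blow-up at the origin with h = x.  It maps
    the half-lines tangent to the zero set of F into the union of the two
    coordinate axes, and no two of them into the same half-axis
    [rays_no_collision].  If it keeps both horizontal half-lines horizontal,
    the previous paragraph applies on both sides.  If it makes one of them
    vertical, reading G in the chart of the y-axis, where
    G (u, +-1) = r(u) u ^ m with r(0) <> 0, turns G o Phi = F into
    f_s (t0 + t) = kappa A_1 (X, t) ^ m and d = m (beta + 1).  Since A_1 (0, t) =
    O(t), f_s is a multiple of (t - t0) ^ m [swapped_height_is_power].  Such an
    F vanishes on the y-axis as well, so the images of four half-lines fill the
    four half-axes.  Then some vertical half-line becomes horizontal, and the
    same argument for the inverse germ shows that the corresponding height of G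
    is a multiple of an m-th power too.  Multiples of m-th powers of linear
    polynomials are equivalent by affine maps; for even m this requires equal
    signs, which are compared on G near the y-axis [swapped_equiv]. *)

(** * Polynomials and limits *)

Lemma poly_eq0_on_itv (R : realType) (p : {poly R}) (a b : R) :
  a < b -> (forall t, a < t < b -> p.[t] = 0) -> p = 0.
Proof.
move=> ab p0; apply/eqP/negP => /negP pN0.
pose u i : R := a + (b - a) / i.+2%:R.
have := @max_poly_roots _ p [seq u i | i <- iota 0 (size p)] pN0.
rewrite size_map size_iota ltnn => H.
suff : false by []; apply: H.
  apply/allP => _ /mapP[i _ ->]; apply/rootP/p0.
  rewrite /u ltrDl divr_gt0 ?subr_gt0 // -ltrBrDl ltr_pdivrMr //.
  by rewrite ltr_pMr ?subr_gt0 // ltr1n.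
rewrite map_inj_uniq ?iota_uniq // => i j /addrI /mulfI.
by rewrite subr_eq0 gt_eqF // => /(_ isT) /invr_inj /eqP; rewrite eqr_nat => /eqP[].
Qed.

Lemma cvg_powR (R : realType) (T : Type) (U : set_system T) (f : T -> R)
    (l r : R) : Filter U -> 0 < l -> f i @[i --> U] --> l ->
  f i `^ r @[i --> U] --> l `^ r.
Proof.
move=> FU l0 fl; apply: (cvg_comp f (fun x => x `^ r) fl).
have : differentiable (fun x : R => x `^ r) l.
  by apply/derivable1_diffP/derivable_powR; rewrite in_itv/= l0.
exact: differentiable_continuous.
Qed.

Lemma cvg_powR0 (R : realType) (T : Type) (U : set_system T) (x : T -> R)
    (r : R) : 0 < r -> x i @[i --> U] --> 0^'+ -> x i `^ r @[i --> U] --> 0.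
Proof. by move=> r0 x0; exact: (cvg_comp x (fun y => y `^ r) x0 (powR_cvg0 r0)). Qed.

Lemma cvg_horner (R : realType) (T : Type) (U : set_system T) (f : T -> R)
    (l : R) (p : {poly R}) : Filter U -> f i @[i --> U] --> l ->
  p.[f i] @[i --> U] --> p.[l].
Proof.
by move=> FU fl; exact: (cvg_comp f (horner p) fl (@continuous_horner _ p l)).
Qed.

Lemma cvg_exprn (R : realType) (T : Type) (U : set_system T) (f : T -> R)
    (l : R) (n : nat) : Filter U -> f i @[i --> U] --> l ->
  f i ^+ n @[i --> U] --> l ^+ n.
Proof.
by move=> FU fl; exact: (cvg_comp f (fun y => y ^+ n) fl (@exprn_continuous R n l)).
Qed.

(** A nonconstant polynomial with positive leading coefficient eventually exceeds
    any bound C, because q = (p - C) / lead_coef p is monic. *)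
Lemma bounded_poly_const (R : realType) (p : {poly R}) (C : R) :
  (forall t, p.[t] <= C) -> (forall t, - C <= p.[t]) -> exists c, p = c%:P.
Proof.
wlog lc : p / 0 < lead_coef p.
  move=> W pC Cp; have [lc|lc|lc] := ltgtP (lead_coef p) 0; last first.
  - by exists 0; apply/eqP; rewrite -lead_coef_eq0 lc.
  - exact: W.
  have [||t|c pc] := W (- p); rewrite ?lead_coefN ?oppr_gt0 //.
  - by move=> t; rewrite hornerN lerNl.
  - by rewrite hornerN lerN2.
  by exists (- c); rewrite polyCN -pc opprK.
move=> pC Cp; have [sp|sp] := leqP (size p) 1%N; first by exists p`_0; exact: size1_polyC.
pose q := (lead_coef p)^-1 *: p - (C / lead_coef p)%:P.
have lt1 : (size (- (C / lead_coef p)%:P) < size ((lead_coef p)^-1 *: p)%R)%N.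
  by rewrite size_polyN size_scale ?invr_eq0 ?gt_eqF // (leq_ltn_trans (size_polyC_leq1 _)).
have qm : q \is monic.
  by rewrite monicE lead_coefDl // lead_coefZ mulVf // gt_eqF.
have [b qb] := monic_Cauchy_bound qm.
have := qb b (lexx b); rewrite /q hornerD hornerN hornerC hornerZ subr_gt0.
by rewrite [_^-1 * _]mulrC ltr_pM2r ?invr_gt0 // ltNge pC.
Qed.

(** The bound near t = 0 makes t0 a root of multiplicity at least m; the bound
    near infinity makes the cofactor of ('X - t0) ^ m constant. *)
Lemma power_of_growth (R : realType) (f : {poly R}) (t0 C : R) (m : nat) :
  f != 0 -> (forall t, `|f.[t0 + t]| <= C * `|t| ^+ m) ->
  exists2 a, a != 0 & f = a *: ('X - t0%:P) ^+ m.
Proof.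
move=> f0 fC; have [k [q qN0 fE]] := multiplicity_XsubC f t0.
rewrite f0 /= in qN0.
have fev t : f.[t0 + t] = q.[t0 + t] * t ^+ k.
  by rewrite fE hornerM horner_exp hornerXsubC addrAC subrr add0r.
have cvq : q.[t0 + t] @[t --> 0^'] --> q.[t0].
  apply: cvg_horner; rewrite -{2}[t0]addr0; apply: cvgD; first exact: cvg_cst.
  by apply: cvg_within_filter; exact: cvg_id.
have mk : (m <= k)%N.
  rewrite leqNgt; apply/negP => km; case/negP: qN0; apply/rootP.
  apply/eqP; rewrite -normr_eq0; apply/eqP.
  apply: (@cvg_unique _ (@Rhausdorff R) (`|q.[t0 + t]| @[t --> 0^'])).
    exact: cvg_norm.
  apply: (@squeeze_cvgr _ _ _ _ (fun=> 0) (fun t : R => C * `|('X^(m - k)).[t]|)).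
  - near=> t; rewrite normr_ge0 /=.
    have t0' : t != 0 by near: t; exact: nbhs_dnbhs_neq.
    have tk : 0 < `|t| ^+ k by rewrite exprn_gt0 ?normr_gt0.
    rewrite hornerXn normrX -(ler_pM2r tk) -mulrA -exprD subnK 1?ltnW //.
    by rewrite -normrX -normrM -fev.
  - exact: cvg_cst.
  - have cv : C * `|('X^(m - k)).[t]| @[t --> 0^'] --> C * `|('X^(m - k)).[0 : R]|.
      apply: cvgM; first exact: cvg_cst.
      apply: cvg_norm; apply: cvg_horner.
      by apply: cvg_within_filter; exact: cvg_id.
    by move: cv; rewrite hornerXn expr0n subn_eq0 leqNgt km normr0 mulr0.
pose r := q * ('X - t0%:P) ^+ (k - m).
have fr : f = r * ('X - t0%:P) ^+ m by rewrite /r -mulrA -exprD subnK.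
have rb t : `|r.[t0 + t]| <= C.
  have main u : u != 0 -> `|r.[t0 + u]| <= C.
    move=> u0; have um : 0 < `|u| ^+ m by rewrite exprn_gt0 ?normr_gt0.
    rewrite -(ler_pM2r um) -normrX -normrM normrX; have := fC u.
    by rewrite fr hornerM horner_exp hornerXsubC addrAC subrr add0r.
  have [->|/main//] := eqVneq t 0.
  have cvr : `|r.[t0 + u]| @[u --> 0^'] --> `|r.[t0 + 0]|.
    apply: cvg_norm; apply: cvg_horner; apply: cvgD; first exact: cvg_cst.
    by apply: cvg_within_filter; exact: cvg_id.
  by apply: (cvgr_to_le cvr); near=> u; apply: main; near: u; exact: nbhs_dnbhs_neq.
have [|t|a ra] := @bounded_poly_const _ r C.
- by move=> t; have := rb (t - t0); rewrite subrKC ler_norml => /andP[].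
- by have := rb (t - t0); rewrite subrKC ler_norml => /andP[].
exists a; last by rewrite fr ra mul_polyC.
by apply: contra_neq f0 => a0; rewrite fr ra a0 mul0r.
Unshelve. all: by end_near. Qed.

(** * Quasihomogeneous polynomials and their heights *)

(** The heights on both sides at once: s = 1 gives the right one, s = -1 the
    left one. *)
Definition height (R : realType) (s : R) (F : {poly {poly R}}) : {poly R} :=
  map_poly (horner_eval s) F.

(** The height in the chart around the half-axis through (0, s). *)
Definition vheight (R : realType) (s : R) (F : {poly {poly R}}) : {poly R} :=
  F.[s%:P].

Lemma heightE (R : realType) (s : R) (F : {poly {poly R}}) (t : R) :
  (height s F).[t] = eval2 F (s, t).
Proof.
have := horner_map (horner_eval s) F t%:P.
by rewrite /= !horner_evalE hornerC.
Qed.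

Lemma unit_sign (R : realType) (s : R) : `|s| = 1 -> s = 1 \/ s = -1.
Proof.
by move=> /eqP; rewrite eqr_norml ler01 andbT => /orP[]/eqP->; [left|right].
Qed.

Section Homogeneity.
Variables (R : realType) (beta : rat) (d : nat) (F : {poly {poly R}}).
Hypotheses (beta_gt1 : 1 < beta) (hF : quasihomogeneous beta d F).
Local Notation b := (ratr beta : R).

Lemma exponent_gt1 : 1 < b.
Proof. by rewrite -(rmorph1 (ratr : rat -> R)) ltr_rat. Qed.

Lemma exponent_gt0 : 0 < b.
Proof. by rewrite (lt_trans ltr01) // exponent_gt1. Qed.

Lemma eval2_height (s x y : R) : 0 < x ->
  eval2 F (s * x, y) = x ^+ d * (height s F).[y / x `^ b].
Proof.
move=> x0; rewrite heightE -hF.2 // mulrC [x `^ b * _]mulrC divfK //.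
by rewrite gt_eqF // powR_gt0.
Qed.

Lemma eval2_vheight (s x y : R) : 0 < y ->
  eval2 F (x, s * y) = (y `^ b^-1) ^+ d * (vheight s F).[x / y `^ b^-1].
Proof.
move=> y0; have t0 : 0 < y `^ b^-1 by rewrite powR_gt0.
have -> : (vheight s F).[x / y `^ b^-1] = eval2 F (x / y `^ b^-1, s) by [].
rewrite -hF.2 // [_ * (x / _)]mulrC divfK ?gt_eqF // -powRrM mulVf.
  by rewrite powRr1 1?mulrC // ltW.
by rewrite gt_eqF // exponent_gt0.
Qed.

Lemma height_neq0 (s : R) : `|s| = 1 -> height s F != 0.
Proof.
move=> s1; apply/eqP => h0; case/eqP: hF.1; apply/polyP => j; rewrite coef0.
have z x y : 0 < x -> eval2 F (s * x, y) = 0.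
  by move=> x0; rewrite eval2_height // h0 horner0 mulr0.
have zj x : 0 < x -> (F`_j).[s * x] = 0.
  move=> x0; have : height (s * x) F = 0.
    by apply: (@poly_eq0_on_itv _ _ 0 1) => // t _; rewrite heightE z.
  by move/(congr1 (fun p : {poly R} => p`_j)); rewrite coef0 coef_map /= horner_evalE.
case: (unit_sign s1) => sE; rewrite sE in zj.
- by apply: (@poly_eq0_on_itv _ _ 0 1) => // t /andP[t0 _]; rewrite -[t]mul1r zj.
- apply: (@poly_eq0_on_itv _ _ (-1) 0); rewrite ?ltrN10 // => t /andP[_ t0].
  by rewrite -[t]opprK -[- - t]mulN1r zj // oppr_gt0.
Qed.

Lemma vheight_neq0 (s : R) : `|s| = 1 -> vheight s F != 0.
Proof.
move=> s1; apply/eqP => v0; have /eqP[] := height_neq0 (normr1 R).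
have z y : 0 < y -> (height 1 F).[s * y] = 0.
  by move=> y0; rewrite heightE eval2_vheight // v0 horner0 mulr0.
case: (unit_sign s1) => sE; rewrite sE in z.
- by apply: (@poly_eq0_on_itv _ _ 0 1) => // t /andP[t0 _]; rewrite -[t]mul1r z.
- apply: (@poly_eq0_on_itv _ _ (-1) 0); rewrite ?ltrN10 // => t /andP[_ t0].
  by rewrite -[t]opprK -[- - t]mulN1r z // oppr_gt0.
Qed.

(** On either side the zero set is a union of curves y = t |x| ^ beta, with t a
    root of the height; the roots are bounded. *)
Lemma zeros_near_axis : exists2 M : R, 0 < M &
  forall q, eval2 F q = 0 -> q.1 != 0 -> `|q.2| <= M * `|q.1| `^ b.
Proof.
have [M1 hM1] := Cauchy_root_bound (height_neq0 (normr1 R)).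
have [M2 hM2] := Cauchy_root_bound (height_neq0 (normrN1 R)).
exists (1 + `|M1| + `|M2|); first by rewrite -addrA ltr_wpDr ?addr_ge0.
move=> [x y] /= q0 x0; have nx : 0 < `|x| by rewrite normr_gt0.
have pw : 0 < `|x| `^ b by rewrite powR_gt0.
have [s sE s1] : exists2 s, x = s * `|x| & `|s| = 1.
  by exists (Num.sg x); rewrite ?mulr_sg_norm -?numEsg // normr_sg x0.
move: q0; rewrite sE eval2_height // normrM s1 normr_id mul1r => /eqP.
rewrite mulf_eq0 expf_eq0 (gt_eqF nx) andbF /= => rt.
suff : `|y / `|x| `^ b| <= 1 + `|M1| + `|M2|.
  by rewrite normrM normfV [`| _ `^ _|]gtr0_norm // ler_pdivrMr.
case: (unit_sign s1) => se; rewrite se in rt.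
- apply: le_trans (hM1 _ rt) _; rewrite (le_trans (ler_norm _)) //.
  by rewrite addrAC ler_wpDl // addr_ge0.
- apply: le_trans (hM2 _ rt) _; rewrite (le_trans (ler_norm _)) //.
  by rewrite ler_wpDl // addr_ge0.
Qed.

End Homogeneity.

(** * Blowing up bi-Lipschitz germs along an ultrafilter *)

Lemma ultra_fmap (T V : Type) (f : T -> V) (U : set_system T) :
  UltraFilter U -> UltraFilter (f @ U).
Proof.
move=> UU; split=> [|G GF UG]; first exact: fmap_proper_filter.
apply/seteqP; split=> // A GA; have [//|UA] := in_ultra_setVsetC (f @^-1` A) UU.
have GnA : G (~` A) by exact: UG.
by have /filter_ex[? []] : G (A `&` ~` A) by exact: filterI.
Qed.

Lemma bounded_ultra_cvg (R : realType) (T : Type) (U : set_system T)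
    (u : T -> R) (M : R) : UltraFilter U ->
  (\forall i \near U, `|u i| <= M) -> exists l : R, u i @[i --> U] --> l.
Proof.
move=> UU uM; have := @segment_compact R (- M) M; rewrite compact_ultra => cM.
have [|l [_ ul]] := cM (u @ U) (ultra_fmap u UU); last by exists l.
apply: filterS uM => i; rewrite ler_norml => uM.
by rewrite /= in_itv.
Qed.

Lemma bounded_ultra_cvg2 (R : realType) (T : Type) (U : set_system T)
    (u : T -> R * R) (M : R) : UltraFilter U ->
  (\forall i \near U, `|u i| <= M) -> exists l : R * R, u i @[i --> U] --> l.
Proof.
move=> UU uM.
have [|l1 h1] := @bounded_ultra_cvg _ _ U (fun i => (u i).1) M.
  by apply: filterS uM => i; rewrite prod_normE ge_max => /andP[].
have [|l2 h2] := @bounded_ultra_cvg _ _ U (fun i => (u i).2) M.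
  by apply: filterS uM => i; rewrite prod_normE ge_max => /andP[].
exists (l1, l2).
have -> : u = (fun i => ((u i).1, (u i).2)) by apply/funext => i; case: (u i).
exact: (cvg_pair h1 h2).
Qed.

(** A bi-Lipschitz germ at the origin and its inverse, with a common Lipschitz
    constant and a common radius, so that the notion is symmetric. *)
Record bilip_germ (R : realType) (Phi Psi : R * R -> R * R) (K rho : R) : Prop := {
  bilip_K : 0 < K;
  bilip_rho : 0 < rho;
  bilip_Phi0 : Phi 0 = 0;
  bilip_Psi0 : Psi 0 = 0;
  bilip_Phi : forall p q, `|p| < rho -> `|q| < rho ->
    `|Phi p - Phi q| <= K * `|p - q|;
  bilip_Psi : forall p q, `|p| < rho -> `|q| < rho ->
    `|Psi p - Psi q| <= K * `|p - q|;
  bilip_PhiK : forall p, `|p| < rho -> Psi (Phi p) = p;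
  bilip_PsiK : forall q, `|q| < rho -> Phi (Psi q) = q }.

Lemma bilip_germ_sym (R : realType) (Phi Psi : R * R -> R * R) (K rho : R) :
  bilip_germ Phi Psi K rho -> bilip_germ Psi Phi K rho.
Proof. by case=> *; split. Qed.

Section Blowup.
Variables (R : realType) (I : Type) (U : set_system I).
Context {UU : UltraFilter U}.

Lemma cvg_scaler0 (h : I -> R) (v : R * R) : h i @[i --> U] --> (0 : R) ->
  h i *: v @[i --> U] --> (0 : R * R).
Proof. by move=> h0; rewrite -(scale0r v); apply: cvgZ => //; exact: cvg_cst. Qed.

(** The rescaled maps are K-Lipschitz where they are defined and bounded at 0, so
    they converge pointwise along the ultrafilter. *)
Lemma blowup_map (Phi Psi : R * R -> R * R) (K rho : R) (p q : I -> R * R)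
    (h : I -> R) (C : R) : bilip_germ Phi Psi K rho ->
  (\forall i \near U, 0 < h i) -> h i @[i --> U] --> (0 : R) ->
  p i @[i --> U] --> (0 : R * R) ->
  (\forall i \near U, `|Phi (p i) - q i| <= C * h i) ->
  exists A : R * R -> R * R,
    (forall v, (h i)^-1 *: (Phi (p i + h i *: v) - q i) @[i --> U] --> A v) /\
    (forall u v, `|A u - A v| <= K * `|u - v|).
Proof.
move=> bg h0 hc pc qC.
have near_rho v : \forall i \near U, `|p i + h i *: v| < rho.
  apply: cvgr0_norm_lt; last exact: bilip_rho bg.
  by rewrite -[0]addr0; apply: cvgD => //; exact: cvg_scaler0.
have diff u v : \forall i \near U,
    `|(h i)^-1 *: (Phi (p i + h i *: u) - q i) -
      (h i)^-1 *: (Phi (p i + h i *: v) - q i)| <= K * `|u - v|.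
  near=> i; have hi : 0 < h i by near: i.
  rewrite -scalerBr prod_norm_scale gtr0_norm ?invr_gt0 // mulrC ler_pdivrMr //.
  rewrite opprB addrA subrK (le_trans (bilip_Phi bg _ _)) //.
  - by near: i; exact: near_rho.
  - by near: i; exact: near_rho.
  rewrite opprD addrACA subrr add0r -scalerBr prod_norm_scale gtr0_norm //.
  by rewrite mulrA mulrAC.
have ex v : exists w : R * R,
    (h i)^-1 *: (Phi (p i + h i *: v) - q i) @[i --> U] --> w.
  apply: (@bounded_ultra_cvg2 _ _ _ _ (K * `|v - 0| + C)); near=> i.
  have hi : 0 < h i by near: i.
  have dv : `|(h i)^-1 *: (Phi (p i + h i *: v) - q i) -
      (h i)^-1 *: (Phi (p i + h i *: 0) - q i)| <= K * `|v - 0|.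
    by near: i; exact: diff.
  rewrite -[X in `|X| <= _](subrK ((h i)^-1 *: (Phi (p i + h i *: 0) - q i))).
  rewrite (le_trans (ler_normD _ _)) // lerD // {dv}.
  rewrite scaler0 addr0 prod_norm_scale gtr0_norm ?invr_gt0 // mulrC.
  by rewrite ler_pdivrMr //; near: i.
have [A hA] := choice ex; exists A; split=> // u v.
have cv : `|(h i)^-1 *: (Phi (p i + h i *: u) - q i) -
    (h i)^-1 *: (Phi (p i + h i *: v) - q i)| @[i --> U] --> `|A u - A v|.
  by apply: cvg_norm; apply: cvgB.
by apply: (cvgr_to_le cv); exact: diff.
Unshelve. all: by end_near. Qed.

(** The rescaled inverse maps are equi-Lipschitz, so evaluating them at the limit
    A v or at the values that converge to A v makes no difference in the limit. *)
Lemma blowup_cancel (Phi Psi : R * R -> R * R) (K rho : R) (p q : I -> R * R)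
    (h : I -> R) (A B : R * R -> R * R) : bilip_germ Phi Psi K rho ->
  (\forall i \near U, 0 < h i) -> h i @[i --> U] --> (0 : R) ->
  p i @[i --> U] --> (0 : R * R) -> q i @[i --> U] --> (0 : R * R) ->
  (forall v, (h i)^-1 *: (Phi (p i + h i *: v) - q i) @[i --> U] --> A v) ->
  (forall w, (h i)^-1 *: (Psi (q i + h i *: w) - p i) @[i --> U] --> B w) ->
  cancel A B.
Proof.
move=> bg h0 hc pc qc hA hB v; apply/eqP; rewrite -subr_eq0 -normr_eq0; apply/eqP.
have cB : `|(h i)^-1 *: (Psi (q i + h i *: A v) - p i) - v| @[i --> U]
    --> `|B (A v) - v|.
  by apply: cvg_norm; apply: cvgB => //; exact: cvg_cst.
apply: (cvg_unique _ cB) => //.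
apply: (@squeeze_cvgr _ _ _ _ (fun=> 0)
  (fun i => K * `|A v - (h i)^-1 *: (Phi (p i + h i *: v) - q i)|)).
- near=> i; rewrite normr_ge0 /=; have hi : 0 < h i by near: i.
  have E : h i *: ((h i)^-1 *: (Phi (p i + h i *: v) - q i)) + q i =
      Phi (p i + h i *: v).
    by rewrite scalerA divff ?gt_eqF // scale1r subrK.
  have pv : `|p i + h i *: v| < rho.
    near: i; apply: cvgr0_norm_lt; last exact: bilip_rho bg.
    by rewrite -[0]addr0; apply: cvgD => //; exact: cvg_scaler0.
  have qv : `|q i + h i *: A v| < rho.
    near: i; apply: cvgr0_norm_lt; last exact: bilip_rho bg.
    by rewrite -[0]addr0; apply: cvgD => //; exact: cvg_scaler0.
  have fv : `|Phi (p i + h i *: v)| < rho.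
    rewrite -E; near: i; apply: cvgr0_norm_lt; last exact: bilip_rho bg.
    by rewrite -[0]addr0; apply: cvgD => //; rewrite -(scale0r (A v)); exact: cvgZ.
  have -> : (h i)^-1 *: (Psi (q i + h i *: A v) - p i) - v =
      (h i)^-1 *: (Psi (q i + h i *: A v) - Psi (Phi (p i + h i *: v))).
    rewrite (bilip_PhiK bg) // opprD [in RHS]addrA [in RHS]scalerBr; congr (_ - _).
    by rewrite scalerA mulVf ?gt_eqF // scale1r.
  rewrite prod_norm_scale gtr0_norm ?invr_gt0 // mulrC ler_pdivrMr //.
  rewrite (le_trans (bilip_Psi bg qv fv)) // -mulrA ler_pM2l ?(bilip_K bg) //.
  rewrite -[X in _ <= _ * X](gtr0_norm hi) mulrC -prod_norm_scale scalerBr.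
  by rewrite -{1}E opprD [- _ - q i]addrC addrACA addrA subrr add0r.
- exact: cvg_cst.
- rewrite -[X in _ --> X](mulr0 K); apply: cvgM; first exact: cvg_cst.
  rewrite -[X in _ --> X](normr0 (R * R)%type) -(subrr (A v)).
  by apply: cvg_norm; apply: cvgB => //; exact: cvg_cst.
Unshelve. all: by end_near. Qed.

(** The centres p and q may be any points that Phi matches up to O(h); this
    freedom lets them be chosen on a coordinate axis. *)
Lemma blowup (Phi Psi : R * R -> R * R) (K rho : R) (p q : I -> R * R)
    (h : I -> R) (C : R) : bilip_germ Phi Psi K rho ->
  (\forall i \near U, 0 < h i) -> h i @[i --> U] --> (0 : R) ->
  p i @[i --> U] --> (0 : R * R) -> q i @[i --> U] --> (0 : R * R) ->
  (\forall i \near U, `|Phi (p i) - q i| <= C * h i) ->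
  exists A B : R * R -> R * R,
    [/\ forall v, (h i)^-1 *: (Phi (p i + h i *: v) - q i) @[i --> U] --> A v,
        forall w, (h i)^-1 *: (Psi (q i + h i *: w) - p i) @[i --> U] --> B w,
        cancel A B, cancel B A &
        (forall u v, `|A u - A v| <= K * `|u - v|) /\
        (forall u v, `|B u - B v| <= K * `|u - v|)].
Proof.
move=> bg h0 hc pc qc qC.
have [A [hA lA]] := blowup_map bg h0 hc pc qC.
have qC' : \forall i \near U, `|Psi (q i) - p i| <= (K * C) * h i.
  near=> i; have pi : `|p i| < rho.
    by near: i; apply: cvgr0_norm_lt; [|exact: bilip_rho bg].
  have qi : `|q i| < rho by near: i; apply: cvgr0_norm_lt; [|exact: bilip_rho bg].
  have fi : `|Phi (p i)| < rho.
    apply: le_lt_trans (_ : K * `|p i - 0| < rho).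
      rewrite -[Phi _]subr0 -[X in _ - X](bilip_Phi0 bg) (bilip_Phi bg) //.
      by rewrite normr0 (bilip_rho bg).
    rewrite mulrC -ltr_pdivlMr ?(bilip_K bg) // subr0.
    near: i; apply: cvgr0_norm_lt => //.
    by rewrite divr_gt0 ?(bilip_rho bg) ?(bilip_K bg).
  rewrite -{1}(bilip_PhiK bg pi) (le_trans (bilip_Psi bg _ _)) //.
  rewrite -mulrA ler_pM2l ?(bilip_K bg) // distrC.
  by near: i.
have [B [hB lB]] := blowup_map (bilip_germ_sym bg) h0 hc qc qC'.
exists A, B; split=> //.
- exact: (blowup_cancel bg h0 hc pc qc hA hB).
- exact: (blowup_cancel (bilip_germ_sym bg) h0 hc qc pc hB hA).
Unshelve. all: by end_near. Qed.

End Blowup.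

(** * Asymptotics of quasihomogeneous polynomials *)

Lemma lipschitz_on_setT (R : realType) (V W : normedModType R) (f : V -> W)
    (K : R) : (forall x y, `|f x - f y| <= K * `|x - y|) ->
  [lipschitz f x | x in [set: V]].
Proof.
move=> fK; exists K; split; first exact: num_real.
move=> k Kk [x y] _ /=; by apply: le_trans (fK x y) _; rewrite ler_wpM2r // ltW.
Qed.

Lemma lipschitz_onP (R : realType) (V W : normedModType R) (f : V -> W)
    (A : set V) : [lipschitz f x | x in A] ->
  exists2 K : R, 0 < K & forall x y, A x -> A y -> `|f x - f y| <= K * `|x - y|.
Proof.
move=> /pinfty_ex_gt0[K K0 fK]; exists K => // x y Ax Ay.
by have := fK (x, y); apply.
Qed.

(** Otherwise, by the intermediate value theorem, g would equal c on an interval. *)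
Lemma lipschitz_level_const (R : realType) (g : {poly R}) (c K : R) (a : R -> R) :
  (forall k, g <> k%:P) -> (forall x y, `|a x - a y| <= K * `|x - y|) ->
  (forall x, g.[a x] = c) -> forall x y, a x = a y.
Proof.
move=> gN aK ac x y; apply/eqP/negPn/negP => axy.
have ca : continuous a.
  move=> u; apply/cvgrPdist_lt => e e0; near=> v.
  apply: le_lt_trans (aK u v) _; apply: (@le_lt_trans _ _ ((`|K| + 1) * `|u - v|)).
    by rewrite ler_wpM2r // ler_wpDr // ler_norm.
  rewrite mulrC -ltr_pdivlMr ?ltr_wpDl //.
  near: v; apply: cvgr_dist_lt; first exact: cvg_id.
  by rewrite divr_gt0 // ltr_wpDl.
have itv m n : a m < a n -> False.
  move=> mn; apply: (gN c); apply/eqP; rewrite -subr_eq0; apply/eqP.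
  apply: (poly_eq0_on_itv mn) => v /andP[mv vn].
  have [u fu] : exists u, a u = v.
    have [le|/ltW le] := leP m n.
      have [||u _ <-] := @IVT R a m n v le; last by exists u.
        exact: continuous_subspaceT.
      by rewrite ge_min le_max (ltW mv) (ltW vn) ?orbT.
    have [||u _ <-] := @IVT R a n m v le; last by exists u.
      exact: continuous_subspaceT.
    by rewrite ge_min le_max (ltW mv) (ltW vn) ?orbT.
  by rewrite hornerD hornerN hornerC -fu ac subrr.
by case: (ltgtP (a x) (a y)) axy => // [xy|yx] _; [apply: itv xy|apply: itv yx].
Unshelve. all: by end_near. Qed.

Section Asymptotics.
Variables (R : realType) (beta : rat) (d : nat) (F : {poly {poly R}}).
Hypotheses (beta_gt1 : 1 < beta) (hF : quasihomogeneous beta d F).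
Local Notation b := (ratr beta : R).
Variables (I : Type) (U : set_system I).
Context {UU : UltraFilter U}.
Variables (x : I -> R).
Hypothesis x0 : x i @[i --> U] --> 0^'+.

Lemma near_pos : \forall i \near U, 0 < x i.
Proof. exact: (x0 (nbhs_right_gt _)). Qed.

Lemma scale_cvg0 : x i @[i --> U] --> (0 : R).
Proof. by move=> A A0; apply: x0; exact: cvg_within. Qed.

Lemma cvg_powR_scale : x i `^ b @[i --> U] --> (0 : R).
Proof. exact: cvg_powR0 (exponent_gt0 R beta_gt1) x0. Qed.

Lemma cvg_powR_scale_div : x i `^ b / x i @[i --> U] --> (0 : R).
Proof.
have b1 : 0 < b - 1 by rewrite subr_gt0 exponent_gt1.
apply: cvg_trans (cvg_powR0 b1 x0); apply: near_eq_cvg; near=> i.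
have xi : 0 < x i by near: i; exact: near_pos.
have xN0 : x i != 0 by rewrite gt_eqF.
by rewrite powRB ?xN0 ?implybT // powRr1 // ltW.
Unshelve. all: by end_near. Qed.

(** To first order F only depends on the side s, on the ratio l of the abscissa to
    x and on the ordinate in units of x ^ beta.  Errors o(x) in the abscissa
    are harmless, while those in the ordinate must be o(x ^ beta). *)
Lemma cvg_eval2_height (s l y : R) (z : I -> R * R) : `|s| = 1 -> 0 < l ->
  (z i).1 / x i @[i --> U] --> s * l -> (z i).2 / x i `^ b @[i --> U] --> y ->
  eval2 F (z i) / x i ^+ d @[i --> U] --> l ^+ d * (height s F).[y / l `^ b].
Proof.
move=> s1 l0 z1 z2; have ss : s * s = 1 by case: (unit_sign s1) => ->; rewrite ?mulrNN mulr1.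
(* w is the abscissa in units of x, made positive by the sign s. *)
pose w i := s * ((z i).1 / x i).
have cw : w i @[i --> U] --> l.
  by rewrite -[l]mul1r -ss -mulrA; apply: cvgM => //; exact: cvg_cst.
have lb : l `^ b != 0 by rewrite gt_eqF // powR_gt0.
have c : w i ^+ d * (height s F).[(z i).2 / x i `^ b / w i `^ b] @[i --> U]
    --> l ^+ d * (height s F).[y / l `^ b].
  apply: cvgM.
    exact: (cvg_comp w (fun u => u ^+ d) cw (@exprn_continuous R d l)).
  apply: cvg_horner; apply: cvgM => //; apply: cvgV => //.
  exact: cvg_powR.
apply: cvg_trans c; apply: near_eq_cvg; near=> i.
have xi : 0 < x i by near: i; exact: near_pos.
have wi : 0 < w i by near: i; exact: cvgr_gt cw _ l0.
have E : z i = (s * (x i * w i), (z i).2).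
  rewrite /w mulrCA [s * (s * _)]mulrA ss mul1r mulrC divfK ?gt_eqF //.
  by case: (z i).
move: (w i) wi E => u u0 E.
rewrite [in RHS]E (eval2_height hF) ?mulr_gt0 // exprMn powRM ?ltW //.
have -> : (z i).2 / (x i `^ b * u `^ b) = (z i).2 / x i `^ b / u `^ b.
  by rewrite invfM mulrA.
by rewrite [RHS]mulrAC [in RHS](mulrAC (x i ^+ d)) divff ?mul1r // expf_neq0 // gt_eqF.
Unshelve. all: by end_near. Qed.

End Asymptotics.

Section VerticalAsymptotics.
Variables (R : realType) (beta : rat) (d : nat) (G : {poly {poly R}}).
Hypotheses (beta_gt1 : 1 < beta) (hG : quasihomogeneous beta d G).
Local Notation b := (ratr beta : R).
Variables (I : Type) (U : set_system I).
Context {UU : UltraFilter U}.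
Variables (x : I -> R).
Hypothesis x0 : x i @[i --> U] --> 0^'+.

(** Near the y-axis the abscissa is of order x ^ beta and the ordinate of order x.
    With tau = |y| ^ (1 / beta) one has G = tau ^ d (vheight) (abscissa / tau)
    where abscissa / tau tends to 0, so that only the lowest power m of the
    vertical height survives.  Counting powers of x gives the exponent. *)
Lemma cvg_eval2_vheight (s c al : R) (m : nat) (r : {poly R}) (z : I -> R * R) :
  `|s| = 1 -> 0 < c -> vheight s G = r * 'X ^+ m ->
  (z i).1 / x i `^ b @[i --> U] --> al -> (z i).2 / x i @[i --> U] --> s * c ->
  eval2 G (z i) / x i `^ (d%:R * b^-1 + m%:R * (b - b^-1)) @[i --> U] -->
  (c `^ b^-1) ^+ d * (r.[0] * (al / c `^ b^-1) ^+ m).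
Proof.
move=> s1 c0 vE z1 z2.
have ss : s * s = 1 by case: (unit_sign s1) => ->; rewrite ?mulrNN mulr1.
have b1 : 1 < b by exact: exponent_gt1.
have b0 : 0 < b by exact: exponent_gt0.
pose w i := s * ((z i).2 / x i); pose o i := (z i).1 / x i `^ b.
have cw : w i @[i --> U] --> c.
  by rewrite -[c]mul1r -ss -mulrA; apply: cvgM => //; exact: cvg_cst.
have cw' : w i `^ b^-1 @[i --> U] --> c `^ b^-1 by exact: cvg_powR.
have cb : c `^ b^-1 != 0 by rewrite gt_eqF // powR_gt0.
have co : o i / w i `^ b^-1 @[i --> U] --> al / c `^ b^-1.
  by apply: cvgM => //; apply: cvgV.
have bb : 0 < b - b^-1.
  by rewrite subr_gt0 (lt_trans _ b1) // invf_lt1.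
have lim : (w i `^ b^-1) ^+ d * (r.[x i `^ (b - b^-1) * (o i / w i `^ b^-1)] *
    (o i / w i `^ b^-1) ^+ m) @[i --> U] -->
    (c `^ b^-1) ^+ d * (r.[0] * (al / c `^ b^-1) ^+ m).
  apply: cvgM; first exact: cvg_exprn.
  apply: cvgM; last exact: cvg_exprn.
  apply: cvg_horner; rewrite -[X in _ --> X](mul0r (al / c `^ b^-1)).
  by apply: cvgM => //; exact: (cvg_powR0 bb x0).
apply: cvg_trans lim; apply: near_eq_cvg; near=> i.
have xi : 0 < x i by near: i; exact: near_pos.
have wi : 0 < w i by near: i; exact: cvgr_gt cw _ c0.
have E2 : s * (x i * w i) = (z i).2.
  by rewrite /w mulrCA [s * (s * _)]mulrA ss mul1r mulrC divfK // gt_eqF.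
have E1 : o i * x i `^ b = (z i).1 by rewrite /o divfK // gt_eqF // powR_gt0.
have -> : z i = (o i * x i `^ b, s * (x i * w i)) by rewrite E1 E2; case: (z i).
move: (w i) (o i) wi => u v u0 {E1 E2}.
rewrite (eval2_vheight beta_gt1 hG) ?mulr_gt0 // powRM ?(ltW xi) ?(ltW u0) //.
have xN0 : x i != 0 by rewrite gt_eqF.
have -> : v * x i `^ b / (x i `^ b^-1 * u `^ b^-1) =
    x i `^ (b - b^-1) * (v / u `^ b^-1).
  rewrite powRB ?xN0 ?implybT // invfM !mulrA; congr (_ / _).
  by rewrite -[LHS]mulrA [LHS]mulrC.
rewrite vE hornerM hornerXn.
have -> : x i `^ (d%:R * b^-1 + m%:R * (b - b^-1)) =
    (x i `^ b^-1) ^+ d * (x i `^ (b - b^-1)) ^+ m.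
  rewrite (@powRD _ _ (d%:R * b^-1)) ?xN0 ?implybT //.
  by congr (_ * _); rewrite mulrC powRrM powR_mulrn ?powR_ge0.
have : x i `^ b^-1 != 0 by rewrite gt_eqF ?powR_gt0.
have : x i `^ (b - b^-1) != 0 by rewrite gt_eqF ?powR_gt0.
move: (x i `^ b^-1) (x i `^ (b - b^-1)) => X Y Y0 X0.
rewrite (exprMn _ X) (exprMn _ Y) [in RHS](mulrCA _ (Y ^+ m)).
by rewrite [in RHS]mulrACA [RHS]mulrC mulKf // mulf_neq0 // expf_neq0.
Unshelve. all: by end_near. Qed.

End VerticalAsymptotics.

(** * Half-lines with a nonzero slope: equivalent heights *)

Section Components.
Variables (R : realType) (I : Type) (U : set_system I).
Context {UU : UltraFilter U}.

Lemma cvg_fst2 (u : I -> R * R) (w : R * R) :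
  u i @[i --> U] --> w -> (u i).1 @[i --> U] --> w.1.
Proof. by move=> uw; apply: (cvg_comp u fst uw); exact: cvg_fst. Qed.

Lemma cvg_snd2 (u : I -> R * R) (w : R * R) :
  u i @[i --> U] --> w -> (u i).2 @[i --> U] --> w.2.
Proof. by move=> uw; apply: (cvg_comp u snd uw); exact: cvg_snd. Qed.

Lemma cvg_pair2 (f g : I -> R) (a b : R) :
  f i @[i --> U] --> a -> g i @[i --> U] --> b ->
  (f i, g i) @[i --> U] --> ((a, b) : R * R).
Proof. by move=> fa gb; exact: (cvg_pair fa gb). Qed.

Lemma cvg_germ0 (Phi Psi : R * R -> R * R) (K rho : R) (p : I -> R * R) :
  bilip_germ Phi Psi K rho -> p i @[i --> U] --> (0 : R * R) ->
  Phi (p i) @[i --> U] --> (0 : R * R).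
Proof.
move=> bg pc; apply/norm_cvg0P.
apply: (@squeeze_cvgr _ _ _ _ (fun=> 0) (fun i => K * `|p i|)).
- near=> i; rewrite normr_ge0 /= -[Phi _]subr0 -[X in _ - X](bilip_Phi0 bg).
  rewrite -[p i in X in _ <= X]subr0 (bilip_Phi bg) ?normr0 ?(bilip_rho bg) //.
  by near: i; apply: cvgr0_norm_lt; [|exact: bilip_rho bg].
- exact: cvg_cst.
- by rewrite -(mulr0 K); apply: cvgM; [exact: cvg_cst|apply/norm_cvg0P].
Unshelve. all: by end_near. Qed.

Lemma snd_dist (p q : R * R) : `|p.2 - q.2| <= `|p - q|.
Proof. by rewrite [leRHS]prod_normE le_max lexx orbT. Qed.

Lemma fst_dist (p q : R * R) : `|p.1 - q.1| <= `|p - q|.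
Proof. by rewrite [leRHS]prod_normE le_max lexx. Qed.

End Components.

Section Heights.
Variables (R : realType) (beta : rat) (d : nat) (F G : {poly {poly R}}).
Hypotheses (beta_gt1 : 1 < beta).
Hypotheses (hF : quasihomogeneous beta d F) (hG : quasihomogeneous beta d G).
Local Notation b := (ratr beta : R).
Variables (Phi Psi : R * R -> R * R) (K rho : R).
Hypothesis bg : bilip_germ Phi Psi K rho.
Hypothesis pull : forall p, `|p| < rho -> eval2 G (Phi p) = eval2 F p.
Variables (I : Type) (U : set_system I).
Context {UU : UltraFilter U}.
Variables (x : I -> R).
Hypothesis x0 : x i @[i --> U] --> 0^'+.
Variables (s t0 : R).
Hypotheses (s1 : `|s| = 1) (ft0 : root (height s F) t0).

Lemma near_pull (p : I -> R * R) : p i @[i --> U] --> (0 : R * R) ->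
  \forall i \near U, eval2 G (Phi (p i)) = eval2 F (p i).
Proof.
move=> pc; near=> i; apply: pull; near: i.
by apply: cvgr0_norm_lt; [|exact: bilip_rho bg].
Unshelve. all: by end_near. Qed.

Lemma cvg_axis0 (y : R) :
  (s * x i, y * x i `^ b) @[i --> U] --> (0 : R * R).
Proof.
have c1 : s * x i @[i --> U] --> s * 0.
  by apply: cvgM; [exact: cvg_cst|exact: scale_cvg0].
have c2 : y * x i `^ b @[i --> U] --> y * 0.
  by apply: cvgM; [exact: cvg_cst|exact: (cvg_powR_scale beta_gt1 x0)].
rewrite mulr0 in c1; rewrite mulr0 in c2; exact: (cvg_pair2 c1 c2).
Qed.

Lemma root_curve_zero :
  \forall i \near U, eval2 G (Phi (s * x i, t0 * x i `^ b)) = 0.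
Proof.
near=> i; have xi : 0 < x i by near: i; exact: near_pos.
transitivity (eval2 F (s * x i, t0 * x i `^ b)).
  by near: i; exact: (near_pull (cvg_axis0 t0)).
rewrite (eval2_height hF) // mulfK ?gt_eqF ?powR_gt0 //.
by rewrite (rootP ft0) mulr0.
Unshelve. all: by end_near. Qed.

(** The curve y = t0 x ^ beta is within O(x ^ beta) of the x-axis, and Phi is
    Lipschitz. *)
Lemma curve_near_axis : \forall i \near U,
  `|Phi (s * x i, t0 * x i `^ b) - Phi (s * x i, 0)| <= K * `|t0| * x i `^ b.
Proof.
near=> i; have xi : 0 < x i by near: i; exact: near_pos.
apply: le_trans (bilip_Phi bg _ _) _.
- by near: i; apply: cvgr0_norm_lt; [exact: cvg_axis0|exact: bilip_rho bg].
- near: i; apply: cvgr0_norm_lt; last exact: bilip_rho bg.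
  by have := cvg_axis0 0; under eq_fun do rewrite mul0r.
rewrite -mulrA ler_pM2l ?(bilip_K bg) // prod_normE /= subrr normr0 subr0.
by rewrite normrM [`|x i `^ b|]ger0_norm ?powR_ge0 // ge_max lexx mulr_ge0 ?powR_ge0.
Unshelve. all: by end_near. Qed.

Lemma curve_slope (l : R) : (Phi (s * x i, 0)).1 / x i @[i --> U] --> l ->
  (Phi (s * x i, t0 * x i `^ b)).1 / x i @[i --> U] --> l.
Proof.
move=> cl; rewrite -[l]addr0.
have -> : (fun i => (Phi (s * x i, t0 * x i `^ b)).1 / x i) =
    (fun i => (Phi (s * x i, 0)).1 / x i +
      ((Phi (s * x i, t0 * x i `^ b)).1 - (Phi (s * x i, 0)).1) / x i).
  by apply/funext => i; rewrite mulrBl addrC subrK.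
apply: cvgD => //; apply/norm_cvg0P.
apply: (@squeeze_cvgr _ _ _ _ (fun=> 0) (fun i => K * `|t0| * (x i `^ b / x i))).
- near=> i; have xi : 0 < x i by near: i; exact: near_pos.
  rewrite normr_ge0 /= normrM normfV [`|x i|]gtr0_norm // mulrA.
  rewrite ler_pM2r ?invr_gt0 // (le_trans (fst_dist _ _)) //.
  by near: i; exact: curve_near_axis.
- exact: cvg_cst.
- rewrite -(mulr0 (K * `|t0|)); apply: cvgM; first exact: cvg_cst.
  exact: (cvg_powR_scale_div beta_gt1 x0).
Unshelve. all: by end_near. Qed.

(** Blow-up at (s x, 0) with scale x ^ beta.  The target centre
    (Phi_1 (s x, 0), 0) is the projection of Phi (s x, 0) to the x-axis. *)
Lemma heights_lipschitz_equiv (l : R) : l != 0 ->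
  (Phi (s * x i, 0)).1 / x i @[i --> U] --> l ->
  lipschitz_equiv (height s F) (height (Num.sg l) G).
Proof.
move=> l0 cl; have l0' : 0 < `|l| by rewrite normr_gt0.
have ss1 : `|Num.sg l| = 1 by rewrite normr_sg l0.
have [M M0 zM] := zeros_near_axis hG.
pose h i := x i `^ b; pose p i : R * R := (s * x i, 0).
pose q i : R * R := ((Phi (p i)).1, 0).
have pc : p i @[i --> U] --> (0 : R * R).
  by have := cvg_axis0 0; under eq_fun do rewrite mul0r.
have h0 : \forall i \near U, 0 < h i.
  by apply: filterS (near_pos x0) => i xi; rewrite powR_gt0.
have hc : h i @[i --> U] --> (0 : R) by exact: (cvg_powR_scale beta_gt1 x0).
have hx : h i / x i @[i --> U] --> (0 : R) by exact: (cvg_powR_scale_div beta_gt1 x0).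
have qc : q i @[i --> U] --> (0 : R * R).
  by apply: cvg_pair2; [exact: (cvg_fst2 (cvg_germ0 bg pc))|exact: cvg_cst].
have zl := curve_slope cl.
(* The image of the curve of roots is a zero of G off the y-axis, hence close
to the x-axis; Phi (p i) is close to that image. *)
have qC : \forall i \near U,
    `|Phi (p i) - q i| <= (K * `|t0| + M * (2 * `|l|) `^ b) * h i.
  near=> i; have xi : 0 < x i by near: i; exact: near_pos.
  have zl1 : `|l| / 2 < `|(Phi (s * x i, t0 * x i `^ b)).1 / x i|.
    by near: i; apply: (cvgr_gt _ (cvg_norm zl)); rewrite ltr_pdivrMr // mulr2n mulrDr mulr1 ltrDl.
  have zl2 : `|(Phi (s * x i, t0 * x i `^ b)).1 / x i| < 2 * `|l|.
    by near: i; apply: (cvgr_lt _ (cvg_norm zl)); rewrite mulrDl mul1r ltrDl.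
  have z0 : eval2 G (Phi (s * x i, t0 * x i `^ b)) = 0.
    by near: i; exact: root_curve_zero.
  have ca : `|Phi (s * x i, t0 * x i `^ b) - Phi (p i)| <= K * `|t0| * h i.
    by near: i; exact: curve_near_axis.
  move: (Phi (s * x i, t0 * x i `^ b)) zl1 zl2 z0 ca => z zl1 zl2 z0 ca.
  rewrite prod_normE /= subrr normr0 subr0 max_r //.
  have z1 : z.1 != 0.
    apply: contraTneq zl1 => ->; rewrite mul0r normr0 -leNgt.
    by rewrite divr_ge0.
  have zz : `|z.2| <= M * (2 * `|l|) `^ b * h i.
    apply: le_trans (zM _ z0 z1) _; rewrite -mulrA ler_pM2l // -powRM ?(ltW xi) //.
      have zx : `|z.1| <= 2 * `|l| * x i.
        by move: zl2; rewrite normrM normfV [`|x i|]gtr0_norm // ltr_pdivrMr // => /ltW.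
      apply: ge0_ler_powR zx; rewrite ?nnegrE //.
        exact: (ltW (exponent_gt0 R beta_gt1)).
      by rewrite mulr_ge0 ?(ltW xi) // mulr_ge0.
  rewrite mulrDl -[(Phi (p i)).2](subrK z.2) (le_trans (ler_normD _ _)) // lerD //.
  by apply: le_trans ca; rewrite distrC prod_normE le_max /= lexx orbT.
have [A [B [hA hB AB BA [lA lB]]]] := blowup bg h0 hc pc qc qC.
(* The identity G o Phi = F divided by x ^ d, in the limit. *)
have key v : (height s F).[v.2] =
    `|l| ^+ d * (height (Num.sg l) G).[(A v).2 / `|l| `^ b].
  pose z i := p i + h i *: v; pose u i := (h i)^-1 *: (Phi (z i) - q i).
  have zc : z i @[i --> U] --> (0 : R * R).
    by rewrite -[0]addr0; apply: cvgD => //; exact: cvg_scaler0.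
  have zE : \forall i \near U, Phi (z i) = q i + h i *: u i.
    apply: filterS h0 => i hi.
    by rewrite scalerA divff ?gt_eqF // scale1r addrC subrK.
  have cF : eval2 F (z i) / x i ^+ d @[i --> U] --> (height s F).[v.2].
    have -> : (height s F).[v.2] = 1 ^+ d * (height s F).[v.2 / 1 `^ b].
      by rewrite expr1n mul1r powR1 divr1.
    apply: (cvg_eval2_height hF x0) => //.
    - apply: (cvg_trans _ (_ : s * 1 + v.1 * (h i / x i) @[i --> U] --> s * 1)).
        apply: near_eq_cvg; near=> i; have xi : 0 < x i by near: i; exact: near_pos.
        by rewrite /= mulrDl mulfK ?gt_eqF // mulr1 mulrA [v.1 * _]mulrC.
      rewrite -[X in _ --> X]addr0 -(mulr0 v.1).
      by apply: cvgD; [exact: cvg_cst|apply: cvgM => //; exact: cvg_cst].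
    - apply: (cvg_trans _ (_ : v.2 @[i --> U] --> v.2)); last exact: cvg_cst.
      apply: near_eq_cvg; near=> i; have hi : 0 < h i by near: i.
      by rewrite /= add0r mulrC mulKf // gt_eqF.
  have cG : eval2 G (Phi (z i)) / x i ^+ d @[i --> U] -->
      `|l| ^+ d * (height (Num.sg l) G).[(A v).2 / `|l| `^ b].
    apply: (cvg_eval2_height hG x0) => //.
    - rewrite mulr_sg_norm.
      apply: (cvg_trans _ (_ : (Phi (p i)).1 / x i + (u i).1 * (h i / x i) @[i --> U] --> l)).
        apply: near_eq_cvg; near=> i.
        have -> : Phi (z i) = q i + h i *: u i by near: i.
        move: (u i) => w; by rewrite /= mulrDl mulrA [w.1 * _]mulrC.
      rewrite -[X in _ --> X]addr0 -(mulr0 (A v).1).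
      by apply: cvgD => //; apply: cvgM => //; exact: (cvg_fst2 (hA v)).
    - apply: (cvg_trans _ (cvg_snd2 (hA v))).
      apply: near_eq_cvg; near=> i; have hi : 0 < h i by near: i.
      by rewrite /= subr0 mulrC.
  apply: (cvg_unique _ cF) => //.
  apply: (cvg_trans _ cG); apply: near_eq_cvg; near=> i; congr (_ / _).
  by near: i; exact: near_pull.
set f := height s F in key *; set g := height (Num.sg l) G in key *.
have fN0 : f != 0 by exact: (height_neq0 hF s1).
have gN0 : g != 0 by exact: (height_neq0 hG ss1).
have ld : `|l| ^+ d != 0 by rewrite expf_neq0 // gt_eqF.
have lb : 0 < `|l| `^ b by rewrite powR_gt0.
have vE (v : R * R) : v = (v.1, v.2) by case: v.
have f_nonconst k : f <> k%:P.
  move=> fk; move/rootP: ft0; rewrite -/f fk hornerC => k0.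
  by move: fN0; rewrite fk k0 eqxx.
have g_nonconst k : g <> k%:P.
  move=> gk; apply: (@f_nonconst (`|l| ^+ d * k)).
  apply/eqP; rewrite -subr_eq0; apply/eqP/(@poly_eq0_on_itv _ _ 0 1) => // t _.
  by rewrite hornerD hornerN hornerC (key (0, t)) gk hornerC subrr.
have A_level t u v : (A (u, t)).2 = (A (v, t)).2.
  apply: (mulIf (invr_neq0 (lt0r_neq0 lb))).
  apply: (@lipschitz_level_const _ g (f.[t] / `|l| ^+ d) (K / `|l| `^ b)
    (fun u => (A (u, t)).2 / `|l| `^ b)) => // [u' v'|u'].
    rewrite -mulrBl normrM normfV (gtr0_norm lb) mulrAC ler_pM2r ?invr_gt0 //.
    apply: le_trans (snd_dist (A (u', t)) (A (v', t))) _.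
    apply: le_trans (lA _ _) _.
    by rewrite prod_normE /= subrr normr0 max_l.
  by rewrite (key (u', t)) mulrAC divff ?mul1r.
have B_level t u v : (B (u, t)).2 = (B (v, t)).2.
  apply: (@lipschitz_level_const _ f (`|l| ^+ d * g.[t / `|l| `^ b]) K
    (fun u => (B (u, t)).2)) => // [u' v'|u'].
    apply: le_trans (snd_dist (B (u', t)) (B (v', t))) _.
    apply: le_trans (lB _ _) _.
    by rewrite prod_normE /= subrr normr0 max_l.
  by rewrite key BA.
split=> //; exists (fun t => (A (0, t)).2 / `|l| `^ b), (`|l| ^+ d)^-1; split.
- exists (fun u => (B (0, `|l| `^ b * u)).2); split.
  + move=> t _; split=> //; rewrite mulrC divfK ?gt_eqF //.
    by rewrite (B_level _ 0 (A (0, t)).1) -vE AB.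
  + move=> u _; split=> //; rewrite (A_level _ 0 (B (0, `|l| `^ b * u)).1) -vE BA /=.
    by rewrite mulrAC divff ?mul1r // gt_eqF.
  + apply: (@lipschitz_on_setT _ _ _ _ (K / `|l| `^ b)) => t u.
    rewrite -mulrBl normrM normfV (gtr0_norm lb) mulrAC ler_pM2r ?invr_gt0 //.
    apply: le_trans (snd_dist (A (0, t)) (A (0, u))) _.
    apply: le_trans (lA _ _) _.
    by rewrite prod_normE /= subrr normr0 max_r.
  + apply: (@lipschitz_on_setT _ _ _ _ (K * `|l| `^ b)) => t u.
    apply: le_trans (snd_dist (B (0, _ * t)) (B (0, _ * u))) _.
    apply: le_trans (lB _ _) _.
    rewrite prod_normE /= subrr normr0 max_r // -mulrBr normrM (gtr0_norm lb).
    by rewrite mulrA.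
- by rewrite invr_gt0 exprn_gt0.
- by move=> t; rewrite (key (0, t)) mulrA mulVf ?mul1r.
Unshelve. all: by end_near. Qed.

End Heights.

(** * Half-lines sent to the y-axis: heights that are powers *)

Section Swap.
Variables (R : realType) (beta : rat) (d : nat) (F G : {poly {poly R}}).
Hypotheses (beta_gt1 : 1 < beta).
Hypotheses (hF : quasihomogeneous beta d F) (hG : quasihomogeneous beta d G).
Local Notation b := (ratr beta : R).
Variables (Phi Psi : R * R -> R * R) (K rho : R).
Hypothesis bg : bilip_germ Phi Psi K rho.
Hypothesis pull : forall p, `|p| < rho -> eval2 G (Phi p) = eval2 F p.
Variables (I : Type) (U : set_system I).
Context {UU : UltraFilter U}.
Variables (x : I -> R).
Hypothesis x0 : x i @[i --> U] --> 0^'+.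
Variables (s t0 : R).
Hypotheses (s1 : `|s| = 1) (ft0 : root (height s F) t0).
Hypothesis slope0 : (Phi (s * x i, 0)).1 / x i @[i --> U] --> (0 : R).

Let p i : R * R := (s * x i, t0 * x i `^ b).

Lemma curve_size : \forall i \near U, x i / K <= `|Phi (p i)| <= K * (1 + `|t0|) * x i.
Proof.
have pc : p i @[i --> U] --> (0 : R * R) by exact: cvg_axis0.
near=> i; have xi : 0 < x i by near: i; exact: near_pos.
have pr : `|p i| < rho by near: i; apply: cvgr0_norm_lt; [|exact: bilip_rho bg].
have fr : `|Phi (p i)| < rho.
  by near: i; apply: cvgr0_norm_lt; [exact: cvg_germ0 bg pc|exact: bilip_rho bg].
have r0 : `|0 : R * R| < rho by rewrite normr0 (bilip_rho bg).
apply/andP; split.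
  rewrite ler_pdivrMr ?(bilip_K bg) // mulrC.
  have := bilip_Psi bg fr r0; rewrite (bilip_Psi0 bg) (bilip_PhiK bg) // !subr0.
  apply: le_trans.
  by rewrite prod_normE le_max /= normrM s1 mul1r (gtr0_norm xi) lexx.
have := bilip_Phi bg pr r0; rewrite (bilip_Phi0 bg) // !subr0 => /le_trans; apply.
rewrite -mulrA ler_pM2l ?(bilip_K bg) // prod_normE ge_max /=.
rewrite normrM s1 mul1r (gtr0_norm xi) mulrDl mul1r lerDl mulr_ge0 ?(ltW xi) //=.
rewrite normrM (ger0_norm (powR_ge0 _ _)) ler_wpDl ?(ltW xi) // ler_wpM2l //.
rewrite -[leRHS]mul1r -ler_pdivrMr //.
near: i; apply: cvgr_le (cvg_powR_scale_div beta_gt1 x0) _ _; exact: ltr01.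
Unshelve. all: by end_near. Qed.

(** A zero of G off the y-axis satisfies |y| <= M |x| ^ beta, so its norm is the
    abscissa, which the vanishing slope makes o(x); but the norm is at least
    x / K. *)
Lemma curve_on_axis : \forall i \near U, (Phi (p i)).1 = 0.
Proof.
have [M M0 zM] := zeros_near_axis hG.
have cz : (Phi (p i)).1 / x i @[i --> U] --> (0 : R).
  exact: (curve_slope beta_gt1 bg x0 t0 slope0).
have cM : M * (x i `^ b / x i) @[i --> U] --> (0 : R).
  rewrite -(mulr0 M); apply: cvgM; first exact: cvg_cst.
  exact: (cvg_powR_scale_div beta_gt1 x0).
have K0 := bilip_K bg; have Ki : 0 < K^-1 by rewrite invr_gt0.
near=> i; have xi : 0 < x i by near: i; exact: near_pos.
have sz : x i / K <= `|Phi (p i)|.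
  by near: i; apply: filterS curve_size => i /andP[].
have z0 : eval2 G (Phi (p i)) = 0.
  by near: i; exact: (root_curve_zero beta_gt1 hF bg pull x0 ft0).
have z1 : `|(Phi (p i)).1 / x i| < Num.min K^-1 1.
  by near: i; apply: cvgr0_norm_lt; rewrite // lt_min Ki ltr01.
have z2 : M * (x i `^ b / x i) < K^-1 by near: i; exact: cvgr_lt cM _ Ki.
move: (Phi (p i)) sz z0 z1 => z sz z0 z1; apply/eqP/negPn/negP => zN.
move: z1; rewrite normrM normfV (gtr0_norm xi) lt_min !ltr_pdivrMr // mul1r => /andP[z1 z1'].
have : `|z| < x i / K.
  rewrite prod_normE gt_max mulrC z1 /=.
  apply: le_lt_trans (zM _ z0 zN) _.
  apply: (@le_lt_trans _ _ (M * x i `^ b)).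
    rewrite ler_pM2l //; apply: ge0_ler_powR (ltW z1'); rewrite ?nnegrE ?(ltW xi) //.
    exact: (ltW (exponent_gt0 R beta_gt1)).
  by rewrite -ltr_pdivrMr // -mulrA.
by rewrite ltNge sz.
Unshelve. all: by end_near. Qed.

Lemma curve_on_axis_dir : exists s' c : R, [/\ `|s'| = 1, 0 < c &
  (Phi (p i)).2 / x i @[i --> U] --> s' * c].
Proof.
have K0 := bilip_K bg.
have n2 : \forall i \near U, K^-1 <= `|(Phi (p i)).2 / x i| <= K * (1 + `|t0|).
  near=> i; have xi : 0 < x i by near: i; exact: near_pos.
  have z1 : (Phi (p i)).1 = 0 by near: i; exact: curve_on_axis.
  have : x i / K <= `|Phi (p i)| <= K * (1 + `|t0|) * x i by near: i; exact: curve_size.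
  rewrite prod_normE z1 normr0 max_r // normrM normfV (gtr0_norm xi).
  by rewrite ler_pdivlMr // mulrC ler_pdivrMr.
have [|l cl] := @bounded_ultra_cvg _ _ U (fun i => (Phi (p i)).2 / x i) (K * (1 + `|t0|)).
  by apply: filterS n2 => i /andP[].
have l0 : l != 0.
  rewrite -normr_gt0 (@lt_le_trans _ _ K^-1) ?invr_gt0 //.
  by apply: cvgr_to_ge (cvg_norm cl) _; apply: filterS n2 => i /andP[].
by exists (Num.sg l), `|l|; rewrite normr_sg l0 normr_gt0 mulr_sg_norm.
Unshelve. all: by end_near. Qed.

(** Blow-up at a point (s x, t0 x ^ beta) of the curve of roots and at its image,
    which lies on the y-axis.  Comparing the two asymptotics of F, of orders
    x ^ d and x ^ e, excludes e > d (the height would vanish) and e < d (A would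
    not be surjective).  The last clause records the sign of the coefficient,
    which is that of G near the y-axis. *)
Lemma swapped_height_is_power : exists (m : nat) (a : R),
  [/\ (0 < m)%N, d%:R = m%:R * (b + 1), a != 0,
      height s F = a *: ('X - t0%:P) ^+ m &
      ~~ odd m -> exists2 s' : R, `|s'| = 1 &
        \forall u \near 0^', 0 < a * eval2 G (u, s')].
Proof.
have [s' [c [s1' c0 cq]]] := curve_on_axis_dir.
have ss : s' * s' = 1 by case: (unit_sign s1') => ->; rewrite ?mulrNN mulr1.
have pc : p i @[i --> U] --> (0 : R * R) by exact: cvg_axis0.
have b0 : 0 < b by exact: exponent_gt0.
have b1 : 1 < b by exact: exponent_gt1.
pose h i := x i `^ b.
have h0 : \forall i \near U, 0 < h i.
  by apply: filterS (near_pos x0) => i xi; rewrite powR_gt0.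
have hc : h i @[i --> U] --> (0 : R) by exact: (cvg_powR_scale beta_gt1 x0).
have hx : h i / x i @[i --> U] --> (0 : R) by exact: (cvg_powR_scale_div beta_gt1 x0).
have qc : Phi (p i) @[i --> U] --> (0 : R * R) by exact: (cvg_germ0 bg pc).
have vN0 : vheight s' G != 0 by exact: (vheight_neq0 beta_gt1 hG s1').
have v0 : root (vheight s' G) 0.
  have [i [yi zi q1 q2]] : exists i, [/\ 0 < s' * ((Phi (p i)).2 / x i),
      0 < x i, (Phi (p i)).1 = 0 & eval2 G (Phi (p i)) = 0].
    have cy : s' * ((Phi (p i)).2 / x i) @[i --> U] --> s' * (s' * c).
      by apply: cvgM => //; exact: cvg_cst.
    apply: (@filter_ex _ U); near=> i; split.
    - near: i; apply: (cvgr_gt _ cy); by rewrite mulrA ss mul1r.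
    - by near: i; exact: near_pos.
    - by near: i; exact: curve_on_axis.
    - by near: i; exact: (root_curve_zero beta_gt1 hF bg pull x0 ft0).
  have y0 : 0 < s' * (Phi (p i)).2.
    by move: yi; rewrite mulrA pmulr_lgt0 // invr_gt0.
  have E : Phi (p i) = (0, s' * (s' * (Phi (p i)).2)).
    by rewrite mulrA ss mul1r -q1; case: (Phi (p i)).
  move: q2; rewrite E (eval2_vheight beta_gt1 hG) // mul0r => /eqP.
  by rewrite mulf_eq0 expf_eq0 gt_eqF ?powR_gt0 // andbF.
have [m [r rN0 vE]] := multiplicity_XsubC (vheight s' G) 0.
rewrite vN0 subr0 /= in rN0 vE.
have m0 : (0 < m)%N.
  rewrite lt0n; apply: contraNneq rN0 => m0.
  by move: v0; rewrite vE m0 expr0 mulr1.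
have qC : \forall i \near U, `|Phi (p i) - Phi (p i)| <= 0 * h i.
  by near=> i; rewrite subrr normr0 mul0r.
have [A [B [hA hB AB BA [lA lB]]]] := blowup bg h0 hc pc qc qC.
set e := d%:R * b^-1 + m%:R * (b - b^-1).
pose ka := (c `^ b^-1) ^+ d * (r.[0] / (c `^ b^-1) ^+ m).
have cb : c `^ b^-1 != 0 by rewrite gt_eqF // powR_gt0.
have kaN0 : ka != 0 by rewrite !mulf_neq0 ?invr_neq0 ?expf_neq0.
have lim v :
    (eval2 F (p i + h i *: v) / x i ^+ d @[i --> U] --> (height s F).[t0 + v.2]) /\
    (eval2 F (p i + h i *: v) / x i `^ e @[i --> U] --> ka * (A v).1 ^+ m).
  pose z i := p i + h i *: v; pose u i := (h i)^-1 *: (Phi (z i) - Phi (p i)).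
  have zc : z i @[i --> U] --> (0 : R * R).
    by rewrite -[0]addr0; apply: cvgD => //; exact: cvg_scaler0.
  have zE : \forall i \near U, Phi (z i) = Phi (p i) + h i *: u i.
    apply: filterS h0 => i hi.
    by rewrite scalerA divff ?gt_eqF // scale1r addrC subrK.
  split.
    have -> : (height s F).[t0 + v.2] = 1 ^+ d * (height s F).[(t0 + v.2) / 1 `^ b].
      by rewrite expr1n mul1r powR1 divr1.
    apply: (cvg_eval2_height hF x0) => //.
    - apply: (cvg_trans _ (_ : s * 1 + v.1 * (h i / x i) @[i --> U] --> s * 1)).
        apply: near_eq_cvg; near=> i; have xi : 0 < x i by near: i; exact: near_pos.
        by rewrite /= mulrDl mulfK ?gt_eqF // mulr1 mulrA [v.1 * _]mulrC.
      rewrite -[X in _ --> X]addr0 -(mulr0 v.1).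
      by apply: cvgD; [exact: cvg_cst|apply: cvgM => //; exact: cvg_cst].
    - apply: (cvg_trans _ (_ : t0 + v.2 @[i --> U] --> t0 + v.2)); last exact: cvg_cst.
      apply: near_eq_cvg; near=> i; have hi : 0 < h i by near: i.
      by rewrite /= mulrDl mulfK ?gt_eqF // [_ *: _]mulrC mulfK // gt_eqF.
  have -> : ka * (A v).1 ^+ m =
      (c `^ b^-1) ^+ d * (r.[0] * ((A v).1 / c `^ b^-1) ^+ m).
    by rewrite expr_div_n /ka -!mulrA [_^-1 * _]mulrC.
  have cG : eval2 G (Phi (z i)) / x i `^ e @[i --> U] -->
      (c `^ b^-1) ^+ d * (r.[0] * ((A v).1 / c `^ b^-1) ^+ m).
    apply: (cvg_eval2_vheight beta_gt1 hG x0 s1' c0 vE).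
    - apply: (cvg_trans _ (cvg_fst2 (hA v))).
      apply: near_eq_cvg; near=> i; have hi : 0 < h i by near: i.
      have q1 : (Phi (p i)).1 = 0 by near: i; exact: curve_on_axis.
      by rewrite /= q1 subr0 mulrC.
    - apply: (cvg_trans _ (_ : (Phi (p i)).2 / x i + (u i).2 * (h i / x i) @[i --> U]
          --> s' * c)).
        apply: near_eq_cvg; near=> i.
        have -> : Phi (z i) = Phi (p i) + h i *: u i by near: i.
        move: (u i) => w; by rewrite /= mulrDl mulrA [w.2 * _]mulrC.
      rewrite -[X in _ --> X]addr0 -(mulr0 (A v).2).
      by apply: cvgD => //; apply: cvgM => //; exact: cvg_snd2 (hA v).
  apply: (cvg_trans _ cG); apply: near_eq_cvg; near=> i; congr (_ / _).
  by near: i; exact: (near_pull bg pull zc).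
have fN0 : height s F != 0 by exact: (height_neq0 hF s1).
have powE y : 0 < y -> y `^ d%:R = y ^+ d by move=> y0; rewrite powR_mulrn // ltW.
have powBE i y z : 0 < x i -> x i `^ (y - z) = x i `^ y / x i `^ z.
  move=> xi; have xN0 : x i != 0 by rewrite gt_eqF.
  by rewrite powRB ?xN0 ?implybT.
(* The first case contradicts the surjectivity of A, the second one f <> 0. *)
have ed : e = d%:R.
  case: (ltgtP e d%:R) => // [ed|de]; exfalso.
  - have A1 v : (A v).1 = 0.
      have [l1 l2] := lim v.
      have l3 : x i `^ (d%:R - e) * (eval2 F (p i + h i *: v) / x i ^+ d) @[i --> U]
          --> 0 * (height s F).[t0 + v.2].
        by apply: cvgM => //; apply: cvg_powR0 x0; rewrite subr_gt0.
      have : ka * (A v).1 ^+ m = 0 * (height s F).[t0 + v.2].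
        apply: (cvg_unique _ l2) => //; apply: (cvg_trans _ l3).
        apply: near_eq_cvg; near=> i.
        have xi : 0 < x i by near: i; exact: near_pos.
        rewrite powBE // powE // mulrCA mulrAC.
        by rewrite divff ?mul1r // expf_neq0 // gt_eqF.
      rewrite mul0r => /eqP; rewrite mulf_eq0 (negbTE kaN0) expf_eq0 m0 /=.
      by move/eqP.
    by have := A1 (B (1, 0)); rewrite BA => /eqP; rewrite oner_eq0.
  - case/eqP: fN0; apply: (@poly_eq0_on_itv _ _ t0 (t0 + 1)); first by rewrite ltrDl.
    move=> t _; have [l1 l2] := lim (0, t - t0); rewrite /= subrKC in l1.
    have l3 : x i `^ (e - d%:R) * (eval2 F (p i + h i *: (0, t - t0)) / x i `^ e) @[i --> U]
        --> 0 * (ka * (A (0, t - t0)).1 ^+ m).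
      by apply: cvgM => //; apply: cvg_powR0 x0; rewrite subr_gt0.
    rewrite mul0r in l3; apply: (cvg_unique _ l1) => //; apply: (cvg_trans _ l3).
    apply: near_eq_cvg; near=> i.
    have xi : 0 < x i by near: i; exact: near_pos.
    rewrite powBE // powE // mulrCA mulrAC.
    by rewrite divff ?mul1r // gt_eqF // powR_gt0.
have fE v : (height s F).[t0 + v.2] = ka * (A v).1 ^+ m.
  have [l1 l2] := lim v; apply: (cvg_unique _ l1) => //.
  apply: (cvg_trans _ l2); apply: near_eq_cvg; near=> i.
  have xi : 0 < x i by near: i; exact: near_pos.
  by rewrite ed powE.
have A0 : A 0 = 0.
  apply: (cvg_unique _ (hA 0)) => //.
  apply: (cvg_trans _ (_ : (0 : R * R) @[_ --> U] --> (0 : R * R))).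
    apply: near_eq_cvg; near=> i.
    by rewrite /= scaler0 addr0 subrr scaler0.
  exact: cvg_cst.
have fC t : `|(height s F).[t0 + t]| <= (`|ka| * K ^+ m) * `|t| ^+ m.
  rewrite (fE (0, t)) normrM -mulrA ler_wpM2l // normrX -exprMn lerXn2r ?nnegrE //.
    by rewrite mulr_ge0 ?(ltW (bilip_K bg)).
  have := le_trans (fst_dist (A (0, t)) (A 0)) (lA _ _).
  by rewrite A0 !subr0 prod_normE /= normr0 max_r.
have [a aN0 aE] := power_of_growth fN0 fC.
exists m, a; split=> //.
  have clear_inv (y : R) : 0 < y ->
      (d%:R * y^-1 + m%:R * (y - y^-1)) * y = d%:R + m%:R * (y * y - 1).
    by move=> y0; rewrite mulrDl -!mulrA mulrBl mulVf ?mulr1 // gt_eqF.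
  have := clear_inv b b0; rewrite -/e ed => H.
  apply: (mulIf (_ : b - 1 != 0)); first by rewrite gt_eqF // subr_gt0.
  by move: H; lra.
move=> me; exists s' => //.
have ar : 0 < a * r.[0].
  have rN0' : r.[0] != 0 by apply: contraNneq rN0 => r0; exact/rootP.
  rewrite lt_neqAle eq_sym mulf_neq0 //=.
  have -> : a = ka * (A (0, 1)).1 ^+ m.
    by rewrite -fE /= aE hornerZ horner_exp hornerXsubC addrAC subrr add0r expr1n mulr1.
  rewrite /ka mulrAC -!mulrA mulr_ge0 ?exprn_ge0 ?powR_ge0 // mulrCA.
  rewrite mulr_ge0 ?invr_ge0 ?exprn_ge0 ?powR_ge0 // mulrA -expr2.
  by rewrite mulr_ge0 // ?sqr_ge0 // exprn_even_ge0.
have cr : a * r.[u] @[u --> 0^'] --> a * r.[0].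
  apply: cvgM; first exact: cvg_cst.
  by apply: cvg_horner; apply: cvg_within_filter; exact: cvg_id.
near=> u; have uN0 : u != 0 by near: u; exact: nbhs_dnbhs_neq.
have -> : eval2 G (u, s') = (vheight s' G).[u] by [].
rewrite vE hornerM hornerXn mulrA mulr_gt0 //.
  by near: u; exact: cvgr_gt cr _ ar.
by rewrite exprn_even_gt0 // uN0 orbT.
Unshelve. all: by end_near. Qed.

End Swap.

(** The map t |-> u0 + mu (t - t0), where mu is the sign of a c; for even m this
    sign has to be 1. *)
Lemma powers_lipschitz_equiv (R : realType) (a c t0 u0 : R) (m : nat) :
  a != 0 -> c != 0 -> (~~ odd m -> 0 < a * c) ->
  lipschitz_equiv (a *: ('X - t0%:P) ^+ m) (c *: ('X - u0%:P) ^+ m).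
Proof.
move=> a0 c0 ac; pose mu := Num.sg (a * c).
have acN0 : a * c != 0 by rewrite mulf_neq0.
have mu1 : `|mu| = 1 by rewrite normr_sg acN0.
have mumu : mu * mu = 1 by case: (unit_sign mu1) => ->; rewrite ?mulrNN mulr1.
have mum : mu ^+ m = mu.
  have [mo|me] := boolP (odd m); last by rewrite /mu gtr0_sg ?ac // expr1n.
  by case: (unit_sign mu1) => ->; rewrite ?expr1n // -signr_odd mo expr1.
have muc : mu * c = `|c| / `|a| * a.
  have sa : `|a|^-1 * a = Num.sg a.
    by rewrite {2}[a]numEsg mulrCA mulVf ?mulr1 // normr_eq0.
  have sc : Num.sg c * c = `|c| by rewrite normrEsg.
  by rewrite /mu sgrM -[LHS]mulrA sc [LHS]mulrC -[RHS]mulrA sa.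
have lip v w : [lipschitz v + mu * (t - w) | t in [set: R]].
  apply: (@lipschitz_on_setT _ _ _ _ 1) => x y.
  by rewrite opprD addrACA subrr add0r -mulrBr opprB addrA subrK normrM mu1.
split.
- by rewrite scaler_eq0 (negbTE a0) expf_neq0 // polyXsubC_eq0.
- by rewrite scaler_eq0 (negbTE c0) expf_neq0 // polyXsubC_eq0.
exists (fun t => u0 + mu * (t - t0)), (`|c| / `|a|); split.
- exists (fun t => t0 + mu * (t - u0)); split=> // t _; split=> //.
    by rewrite addrAC subrr add0r mulrA mumu mul1r subrKC.
  by rewrite addrAC subrr add0r mulrA mumu mul1r subrKC.
- by rewrite divr_gt0 ?normr_gt0.
- move=> t; rewrite !hornerZ !horner_exp !hornerXsubC addrAC subrr add0r exprMn mum.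
  by rewrite mulrA [c * mu]mulrC muc mulrA.
Qed.

(** On the side s, F is a x ^ m (y - t0 x ^ beta) ^ m with m > 0; let x tend to 0. *)
Lemma power_height_vertical_zero (R : realType) (beta : rat) (d : nat)
    (F : {poly {poly R}}) (s a t0 : R) (m : nat) : 1 < beta ->
  quasihomogeneous beta d F -> `|s| = 1 -> (0 < m)%N ->
  d%:R = m%:R * ((ratr beta : R) + 1) -> height s F = a *: ('X - t0%:P) ^+ m ->
  forall y, eval2 F (0, y) = 0.
Proof.
move=> beta_gt1 hF s1 m0 dE fE y; set b : R := ratr beta in dE *.
have b0 : 0 < b by exact: exponent_gt0.
have c1 : (vheight y F).[s * x] @[x --> 0^'+] --> (vheight y F).[s * 0].
  apply: cvg_horner; apply: cvgM; first exact: cvg_cst.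
  by apply: cvg_within_filter; exact: cvg_id.
rewrite mulr0 in c1.
have id0 : x @[x --> 0^'+] --> (0 : R) by apply: cvg_within_filter; exact: cvg_id.
have c2 : a * (x ^+ m * (y - t0 * x `^ b) ^+ m) @[x --> 0^'+] -->
    a * (0 ^+ m * (y - t0 * 0) ^+ m).
  apply: cvgM; first exact: cvg_cst.
  apply: cvgM; first exact: cvg_exprn.
  apply: cvg_exprn; apply: cvgB; first exact: cvg_cst.
  by apply: cvgM; [exact: cvg_cst|exact: powR_cvg0].
rewrite expr0n gtn_eqF // mul0r mulr0 in c2.
apply: (cvg_unique _ c1) => //; apply: (cvg_trans _ c2).
apply: near_eq_cvg; near=> x; have x0 : 0 < x by near: x; exact: nbhs_right_gt.
have -> : (vheight y F).[s * x] = eval2 F (s * x, y) by [].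
rewrite (eval2_height hF) // -/b fE hornerZ horner_exp hornerXsubC.
have -> : x ^+ d = x ^+ m * (x `^ b) ^+ m.
  rewrite -!powR_mulrn ?(ltW x0) ?powR_ge0 // dE mulrDr mulr1 addrC.
  rewrite powRD ?(gt_eqF x0) ?implybT //; congr (_ * _).
  by rewrite mulrC powRrM.
rewrite [RHS]mulrCA -[X in _ = _ * X]mulrA -[in RHS]exprMn; congr (_ * (_ * _ ^+ _)).
by rewrite mulrBr mulrC [x `^ b * (_ / _)]mulrC divfK // gt_eqF // powR_gt0.
Unshelve. all: by end_near. Qed.

(** * The tangent map *)

(** Along the half-line through v, the coordinate c of A grows continuously from 0
    and takes the value c (A u) on the way to c (A v).  There the other
    coordinate c' vanishes, as it does at A u, so that A takes the value A u.
    The lemma is applied with c and c' the two projections in either order. *)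
Lemma ray_hit (R : realType) (A : R * R -> R * R) (K : R) (c c' : R * R -> R)
    (u v : R * R) : (forall p q, `|A p - A q| <= K * `|p - q|) ->
  injective A -> A 0 = 0 -> c 0 = 0 -> (forall p q, `|c p - c q| <= `|p - q|) ->
  (forall p q, c p = c q -> c' p = c' q -> p = q) ->
  (c (A u) = 0 \/ c' (A u) = 0) ->
  (forall k, 0 < k -> c (A (k *: v)) = 0 \/ c' (A (k *: v)) = 0) ->
  0 < c (A u) * c (A v) -> `|c (A u)| <= `|c (A v)| ->
  exists2 k, 0 < k & u = k *: v.
Proof.
move=> lA iA A0 c0 lc cc' Xu Xv uv le_uv.
have cuN0 : c (A u) != 0 by apply: contraTneq uv => ->; rewrite mul0r ltxx.
have ct : continuous (fun k : R => c (A (k *: v)) : R).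
  move=> k; apply/cvgrPdist_lt => e e0; near=> l.
  apply: le_lt_trans (lc _ _) _; apply: le_lt_trans (lA _ _) _.
  apply: (@le_lt_trans _ _ ((`|K| + 1) * (`|v| + 1) * `|k - l|)).
    rewrite -scalerBl prod_norm_scale mulrCA mulrC.
    by rewrite ler_wpM2r // (le_trans (ler_wpM2r _ (ler_norm K))) // ler_pM ?lerDl.
  rewrite mulrC -ltr_pdivlMr ?mulr_gt0 ?ltr_wpDl //.
  near: l; apply: cvgr_dist_lt; first exact: cvg_id.
  by rewrite divr_gt0 // mulr_gt0 ?ltr_wpDl.
have [||k kI kE] := @IVT R (fun k => c (A (k *: v))) 0 1 (c (A u)) ler01.
- exact: continuous_subspaceT.
- rewrite scale0r A0 c0 scale1r ge_min le_max.
  have [cu|cu|cu] := ltgtP (c (A u)) 0; last by rewrite cu eqxx in cuN0.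
  + have cv : c (A v) < 0 by rewrite -(nmulr_rgt0 _ cu).
    by move: le_uv; rewrite (ltr0_norm cu) (ltr0_norm cv) lerN2 => ->; rewrite orbT.
  + have cv : 0 < c (A v) by rewrite -(pmulr_rgt0 _ cu).
    by move: le_uv; rewrite (gtr0_norm cu) (gtr0_norm cv) => ->; rewrite orbT.
have k0 : 0 < k.
  rewrite lt_neqAle; move: kI; rewrite in_itv /= => /andP[-> _]; rewrite andbT eq_sym.
  by apply: contraNneq cuN0 => k0; rewrite -kE k0 scale0r A0 c0.
exists k => //; apply: iA; apply: cc' => //.
case: Xu => [/eqP|->]; first by rewrite (negbTE cuN0).
by case: (Xv k k0) => [/eqP|->//]; rewrite kE (negbTE cuN0).
Unshelve. all: by end_near. Qed.

Definition cross (R : realType) (w : R * R) : Prop := w.1 = 0 \/ w.2 = 0.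

Definition cross_ray (R : realType) (A : R * R -> R * R) (u : R * R) : Prop :=
  forall k, 0 < k -> cross (A (k *: u)).

Definition not_codirectional (R : realType) (u v : R * R) : Prop :=
  forall k, 0 < k -> u <> k *: v /\ v <> k *: u.

(** Two half-lines sent into the same half-axis would meet, by [ray_hit]. *)
Lemma rays_no_collision (R : realType) (A : R * R -> R * R) (K : R)
    (u v : R * R) : (forall p q, `|A p - A q| <= K * `|p - q|) ->
  injective A -> A 0 = 0 -> cross_ray A u -> cross_ray A v ->
  not_codirectional u v ->
  (A u).1 * (A v).1 <= 0 /\ (A u).2 * (A v).2 <= 0.
Proof.
move=> lA iA A0 Xu Xv uv; have Xu1 := Xu 1 ltr01; have Xv1 := Xv 1 ltr01.
rewrite !scale1r in Xu1 Xv1.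
have pairE (p q : R * R) : p.1 = q.1 -> p.2 = q.2 -> p = q.
  by case: p q => [? ?] [? ?] /= -> ->.
have swap (p q : R * R) : p.2 = q.2 -> p.1 = q.1 -> p = q by move=> ? ?; exact: pairE.
have sC (P Q : Prop) : P \/ Q -> Q \/ P by case; [right|left].
split; rewrite leNgt; apply/negP => H.
- have [le|/ltW le] := leP `|(A u).1| `|(A v).1|.
  + have [//|k k0 kE] := ray_hit lA iA A0 _ (@fst_dist R) pairE Xu1 Xv H le.
    by case: (uv k k0).
  + rewrite mulrC in H.
    have [//|k k0 kE] := ray_hit lA iA A0 _ (@fst_dist R) pairE Xv1 Xu H le.
    by case: (uv k k0).
- have [le|/ltW le] := leP `|(A u).2| `|(A v).2|.
  + have [//|k k0|k k0 kE] := ray_hit lA iA A0 _ (@snd_dist R) swap (sC _ _ Xu1) _ H le.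
      exact: sC (Xv k k0).
    by case: (uv k k0).
  + rewrite mulrC in H.
    have [//|k k0|k k0 kE] := ray_hit lA iA A0 _ (@snd_dist R) swap (sC _ _ Xv1) _ H le.
      exact: sC (Xu k k0).
    by case: (uv k k0).
Qed.

Section Tangent.
Variables (R : realType) (beta : rat) (d : nat) (F G : {poly {poly R}}).
Hypotheses (beta_gt1 : 1 < beta).
Hypotheses (hF : quasihomogeneous beta d F) (hG : quasihomogeneous beta d G).
Local Notation b := (ratr beta : R).
Variables (Phi Psi : R * R -> R * R) (K rho : R).
Hypothesis bg : bilip_germ Phi Psi K rho.
Hypothesis pull : forall p, `|p| < rho -> eval2 G (Phi p) = eval2 F p.
Variables (I : Type) (U : set_system I).
Context {UU : UltraFilter U}.
Variables (x : I -> R).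
Hypothesis x0 : x i @[i --> U] --> 0^'+.

(** The tangent map of Phi at the origin, that is the blow-up with scale x there. *)
Lemma tangent_germ : exists A B : R * R -> R * R,
  [/\ forall v, (x i)^-1 *: Phi (x i *: v) @[i --> U] --> A v,
      forall w, (x i)^-1 *: Psi (x i *: w) @[i --> U] --> B w,
      cancel A B, cancel B A &
      A 0 = 0 /\ forall u v, `|A u - A v| <= K * `|u - v|].
Proof.
pose o (i : I) : R * R := 0.
have oc : o i @[i --> U] --> (0 : R * R) by exact: cvg_cst.
have C : \forall i \near U, `|Phi (o i) - o i| <= 0 * x i.
  by near=> i; rewrite (bilip_Phi0 bg) subrr normr0 mul0r.
have [A [B [hA hB AB BA [lA lB]]]] := blowup bg (near_pos x0) (scale_cvg0 x0) oc oc C.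
have hA' v : (x i)^-1 *: Phi (x i *: v) @[i --> U] --> A v.
  apply: (cvg_trans _ (hA v)); apply: near_eq_cvg; near=> i.
  by rewrite /o add0r subr0.
exists A, B; split=> //; last split=> //.
- move=> w; apply: (cvg_trans _ (hB w)); apply: near_eq_cvg; near=> i.
  by rewrite /o add0r subr0.
- apply: (cvg_unique _ (hA' 0)) => //.
  apply: (cvg_trans _ (_ : (0 : R * R) @[_ --> U] --> (0 : R * R))).
    apply: near_eq_cvg; near=> i.
    by rewrite /= scaler0 (bilip_Phi0 bg) scaler0.
  exact: cvg_cst.
Unshelve. all: by end_near. Qed.

Variable A : R * R -> R * R.
Hypothesis hA : forall v, (x i)^-1 *: Phi (x i *: v) @[i --> U] --> A v.

Lemma tangent_cvg (p : I -> R * R) (u : R * R) :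
  (x i)^-1 *: p i @[i --> U] --> u -> p i @[i --> U] --> (0 : R * R) /\
  (x i)^-1 *: Phi (p i) @[i --> U] --> A u.
Proof.
move=> pu; have cx := scale_cvg0 x0.
have pc : p i @[i --> U] --> (0 : R * R).
  have c0 : x i *: ((x i)^-1 *: p i) @[i --> U] --> 0 *: u by exact: cvgZ.
  rewrite scale0r in c0; apply: (cvg_trans _ c0).
  apply: near_eq_cvg; near=> i; have xi : 0 < x i by near: i; exact: near_pos.
  by rewrite /= scalerA divff ?gt_eqF // scale1r.
split=> //; rewrite -[A u]addr0.
have -> : (fun i => (x i)^-1 *: Phi (p i)) = (fun i => (x i)^-1 *: Phi (x i *: u) +
    (x i)^-1 *: (Phi (p i) - Phi (x i *: u))).
  by apply/funext => i; rewrite -scalerDr addrC subrK.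
apply: cvgD => //; apply/norm_cvg0P.
apply: (@squeeze_cvgr _ _ _ _ (fun=> 0) (fun i => K * `|(x i)^-1 *: p i - u|)).
- near=> i; rewrite normr_ge0 /=; have xi : 0 < x i by near: i; exact: near_pos.
  have pr : `|p i| < rho by near: i; apply: cvgr0_norm_lt; [|exact: bilip_rho bg].
  have ur : `|x i *: u| < rho.
    by near: i; apply: cvgr0_norm_lt; [exact: cvg_scaler0|exact: bilip_rho bg].
  have -> : (x i)^-1 *: p i - u = (x i)^-1 *: (p i - x i *: u).
    by rewrite scalerBr scalerA mulVf ?gt_eqF // scale1r.
  rewrite !prod_norm_scale mulrCA ler_pM2l ?normr_gt0 ?invr_neq0 ?gt_eqF //.
  exact: (bilip_Phi bg pr ur).
- exact: cvg_cst.
- rewrite -(mulr0 K); apply: cvgM; first exact: cvg_cst.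
  rewrite -(normr0 (R * R)%type) -(subrr u).
  by apply: cvg_norm; apply: cvgB => //; exact: cvg_cst.
Unshelve. all: by end_near. Qed.

(** Zeros of G off the y-axis satisfy |y| <= M |x| ^ beta, so the tangent cone of
    the zero set is contained in the union of the two axes. *)
Lemma tangent_cross (p : I -> R * R) (u : R * R) :
  (\forall i \near U, eval2 F (p i) = 0) ->
  (x i)^-1 *: p i @[i --> U] --> u -> cross (A u).
Proof.
move=> p0 pu; have [pc zA] := tangent_cvg pu.
have [M M0 zM] := zeros_near_axis hG.
have [|w0] := eqVneq (A u).1 0; [by left|right].
have c1 := cvg_fst2 zA; have c2 := cvg_snd2 zA.
have w0' : 0 < `|(A u).1| by rewrite normr_gt0.
apply/eqP; rewrite -normr_eq0; apply/eqP.
apply: (cvg_unique _ (cvg_norm c2)) => //.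
apply: (@squeeze_cvgr _ _ _ _ (fun=> 0) (fun i =>
  M * (`|((x i)^-1 *: Phi (p i)).1| `^ b * (x i `^ b / x i)))).
- near=> i; rewrite normr_ge0 /=; have xi : 0 < x i by near: i; exact: near_pos.
  have z0 : eval2 G (Phi (p i)) = 0.
    transitivity (eval2 F (p i)); last by near: i.
    by near: i; exact: (near_pull bg pull pc).
  have z1 : 0 < `|((x i)^-1 *: Phi (p i)).1|.
    by near: i; exact: cvgr_gt (cvg_norm c1) _ w0'.
  move: (Phi (p i)) z0 z1 => z z0; rewrite /= !normrM normfV (gtr0_norm xi) => z1.
  have z1' : z.1 != 0 by apply: contraTneq z1 => ->; rewrite normr0 mulr0 ltxx.
  rewrite powRM ?invr_ge0 ?(ltW xi) // mulrC ler_pdivrMr //.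
  apply: le_trans (zM _ z0 z1') _.
  have cancel_x (v w y t : R) : y != 0 -> v * w = 1 -> M * (v * t * (w / y)) * y = M * t.
    by move=> y0 vw; rewrite -!mulrA mulVf // mulr1 [t * w]mulrC [v * _]mulrA vw mul1r.
  rewrite cancel_x ?gt_eqF // -powRM ?invr_ge0 ?(ltW xi) // mulVf ?gt_eqF //.
  by rewrite powR1.
- exact: cvg_cst.
- rewrite -(mulr0 M); apply: cvgM; first exact: cvg_cst.
  rewrite -(mulr0 (`|(A u).1| `^ b)); apply: cvgM.
    by apply: cvg_powR => //; exact: cvg_norm.
  exact: (cvg_powR_scale_div beta_gt1 x0).
Unshelve. all: by end_near. Qed.

Lemma root_cross_ray (s t : R) : root (height s F) t -> cross_ray A (s, 0).
Proof.
move=> ft k k0.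
apply: (@tangent_cross (fun i => (s * (k * x i), t * (k * x i) `^ b))).
  near=> i; have xi : 0 < x i by near: i; exact: near_pos.
  rewrite (eval2_height hF) ?mulr_gt0 // mulfK ?gt_eqF ?powR_gt0 ?mulr_gt0 //.
  by rewrite (rootP ft) mulr0.
apply: cvg_pair2 => /=.
- apply: (cvg_trans _ (_ : k * s @[_ --> U] --> k * s)); last exact: cvg_cst.
  apply: near_eq_cvg; near=> i; have xi : 0 < x i by near: i; exact: near_pos.
  by rewrite /= [_ *: _]mulrC mulrA mulfK ?gt_eqF // mulrC.
- apply: (cvg_trans _ (_ : t * k `^ b * (x i `^ b / x i) @[i --> U] --> k * 0)).
    apply: near_eq_cvg; near=> i; have xi : 0 < x i by near: i; exact: near_pos.
    by rewrite /= powRM ?(ltW k0) ?(ltW xi) // [_ *: _]mulrC !mulrA.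
  rewrite mulr0 -(mulr0 (t * k `^ b)); apply: cvgM; first exact: cvg_cst.
  exact: (cvg_powR_scale_div beta_gt1 x0).
Unshelve. all: by end_near. Qed.

Lemma vertical_cross_ray (s : R) :
  (forall y, eval2 F (0, y) = 0) -> cross_ray A (0, s).
Proof.
move=> F0 k k0; apply: (@tangent_cross (fun i => x i *: (k *: (0, s)))).
  near=> i; have -> : x i *: (k *: (0, s)) = (0, x i * (k * s)) :> R * R.
    by apply: (congr2 pair); rewrite /= ?scaler0.
  exact: F0.
apply: (cvg_trans _ (_ : k *: ((0, s) : R * R) @[_ --> U] --> k *: ((0, s) : R * R))).
  apply: near_eq_cvg; near=> i; have xi : 0 < x i by near: i; exact: near_pos.
  by rewrite scalerA mulVf ?gt_eqF // scale1r.
exact: cvg_cst.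
Unshelve. all: by end_near. Qed.

Lemma tangent_slope (s : R) : (Phi (s * x i, 0)).1 / x i @[i --> U] --> (A (s, 0)).1.
Proof.
have c1 := cvg_fst2 (@hA (s, 0)).
apply: cvg_trans c1; apply: near_eq_cvg; near=> i.
have -> : x i *: (s, 0) = (s * x i, 0) :> R * R.
  by apply: (congr2 pair); rewrite /= ?scaler0 // [RHS]mulrC.
by rewrite [RHS]mulrC.
Unshelve. all: by end_near. Qed.

End Tangent.

(** * Matching the heights of both polynomials *)

Lemma cvg_at_right0 (R : realType) (I : Type) (U : set_system I) (f : I -> R) :
  Filter U -> f i @[i --> U] --> (0 : R) -> (\forall i \near U, 0 < f i) ->
  f i @[i --> U] --> 0^'+.
Proof.
move=> FU f0 fp A A0; have := f0 _ A0; apply: filter_app.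
by apply: filterS fp => i fi; apply.
Qed.

Lemma sg_same (R : realType) (w v : R) : 0 < w * v -> Num.sg w = Num.sg v.
Proof.
have [w0|w0|->] := ltgtP w 0; last by rewrite mul0r ltxx.
- by rewrite nmulr_rgt0 // => v0; rewrite !ltr0_sg.
- by rewrite pmulr_rgt0 // => v0; rewrite !gtr0_sg.
Qed.

Lemma sg_opposite (R : realType) (w v : R) :
  w != 0 -> v != 0 -> w * v <= 0 -> Num.sg v = - Num.sg w.
Proof.
move=> w0 v0 wv; rewrite (@sg_same _ w (- v)) ?sgrN ?opprK //.
by rewrite mulrN oppr_gt0 lt_neqAle mulf_neq0.
Qed.

(** For even m the sign of G on the side e is that of c up to the y-axis, and G is
    nonzero with the sign of a near the axis. *)
Lemma sign_at_axis (R : realType) (beta : rat) (d : nat) (G : {poly {poly R}})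
    (a c t e s : R) (m : nat) : quasihomogeneous beta d G -> `|e| = 1 ->
  ~~ odd m -> height e G = c *: ('X - t%:P) ^+ m ->
  (\forall u \near 0^', 0 < a * eval2 G (u, s)) -> 0 < a * c.
Proof.
move=> hG e1 me gE /nbhs_ballP[r /= r0 rP].
have y0 : 0 < r / 2 by rewrite divr_gt0.
have eN0 : e != 0 by rewrite -normr_gt0 e1.
have := rP (e * (r / 2)); rewrite /ball /= sub0r normrN normrM e1 mul1r gtr0_norm //.
rewrite ltr_pdivrMr // mulr_natr mulr2n ltrDl r0 mulf_neq0 ?(gt_eqF y0) //.
move=> /(_ isT isT); rewrite (eval2_height hG) // gE hornerZ horner_exp hornerXsubC.
rewrite mulrCA pmulr_rgt0 ?exprn_gt0 // mulrA => H.
have q0 : 0 <= (s / (r / 2) `^ ratr beta - t) ^+ m by rewrite exprn_even_ge0.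
have [q00|qN0] := eqVneq ((s / (r / 2) `^ ratr beta - t) ^+ m) 0.
  by rewrite q00 mulr0 ltxx in H.
by rewrite pmulr_lgt0 // lt_neqAle eq_sym qN0 in H.
Qed.

Section Matching.
Variables (R : realType) (beta : rat) (d : nat) (F G : {poly {poly R}}).
Hypotheses (beta_gt1 : 1 < beta).
Hypotheses (hF : quasihomogeneous beta d F) (hG : quasihomogeneous beta d G).
Local Notation b := (ratr beta : R).
Variables (Phi Psi : R * R -> R * R) (K rho : R).
Hypothesis bg : bilip_germ Phi Psi K rho.
Hypothesis pullG : forall p, `|p| < rho -> eval2 G (Phi p) = eval2 F p.
Hypothesis pullF : forall q, `|q| < rho -> eval2 F (Psi q) = eval2 G q.
Variables (I : Type) (U : set_system I).
Context {UU : UltraFilter U}.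
Variables (x : I -> R).
Hypothesis x0 : x i @[i --> U] --> 0^'+.
Variables A B : R * R -> R * R.
Hypothesis hA : forall v, (x i)^-1 *: Phi (x i *: v) @[i --> U] --> A v.
Hypothesis hB : forall v, (x i)^-1 *: Psi (x i *: v) @[i --> U] --> B v.
Hypotheses (AB : cancel A B) (A0 : A 0 = 0).
Hypothesis lA : forall u v, `|A u - A v| <= K * `|u - v|.

Lemma vertical_root (s : R) : (forall y, eval2 F (0, y) = 0) ->
  (A (0, s)).1 != 0 -> exists t, root (height (Num.sg (A (0, s)).1) G) t.
Proof.
move=> F0 al0; set al := (A (0, s)).1 in al0 *.
have c1 : al * ((x i)^-1 *: Phi (x i *: (0, s))).1 @[i --> U] --> al * al.
  by apply: cvgM; [exact: cvg_cst|exact: (cvg_fst2 (@hA (0, s)))].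
have al2 : 0 < al * al by rewrite -expr2 exprn_even_gt0.
have pc : x i *: ((0, s) : R * R) @[i --> U] --> (0 : R * R).
  by apply: cvg_scaler0; exact: scale_cvg0.
have [i [xi zi Gi]] : exists i, [/\ 0 < x i,
    0 < al * ((x i)^-1 *: Phi (x i *: (0, s))).1 & eval2 G (Phi (x i *: (0, s))) = 0].
  apply: (@filter_ex _ U); near=> i; split.
  - by near: i; exact: near_pos.
  - by near: i; exact: cvgr_gt c1 _ al2.
  - transitivity (eval2 F (x i *: (0, s))).
      by near: i; exact: (near_pull bg pullG pc).
    have -> : x i *: (0, s) = (0, x i * s) :> R * R.
      by apply: (congr2 pair); rewrite /= ?scaler0.
    exact: F0.
move: (Phi _) zi Gi => [z1 z2] /= zi Gi.
have az : 0 < al * z1 by rewrite mulrCA pmulr_rgt0 ?invr_gt0 // in zi.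
have zN0 : z1 != 0 by apply: contraTneq az => ->; rewrite mulr0 ltxx.
have sz := sg_same az.
have zE : z1 = Num.sg al * `|z1| by rewrite sz -numEsg.
exists (z2 / `|z1| `^ b); move: Gi; rewrite {1}zE (eval2_height hG) ?normr_gt0 //.
by move/eqP; rewrite mulf_eq0 expf_eq0 normr_eq0 (negbTE zN0) andbF.
Unshelve. all: by end_near. Qed.

(** [swapped_height_is_power] for the inverse germ, along the scale |al| x: with
    that scale Psi has slope 0 on its horizontal half-line, since the tangent map
    sends (al, 0) back to (0, s). *)
Lemma vertical_to_power (s : R) : (forall y, eval2 F (0, y) = 0) ->
  (A (0, s)).1 != 0 -> (A (0, s)).2 = 0 -> exists m a t,
    [/\ (0 < m)%N, d%:R = m%:R * (b + 1), a != 0 &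
        height (Num.sg (A (0, s)).1) G = a *: ('X - t%:P) ^+ m].
Proof.
move=> F0 al0 A2; have [t gt] := vertical_root F0 al0.
set al := (A (0, s)).1 in al0 gt *.
have nal : 0 < `|al| by rewrite normr_gt0.
have x0' : `|al| * x i @[i --> U] --> 0^'+.
  apply: cvg_at_right0.
    by rewrite -(mulr0 `|al|); apply: cvgM; [exact: cvg_cst|exact: scale_cvg0].
  by apply: filterS (near_pos x0) => i xi; rewrite mulr_gt0.
have slope : (Psi (Num.sg al * (`|al| * x i), 0)).1 / (`|al| * x i) @[i --> U] --> (0 : R).
  have alE : (al, 0) = A (0, s) by rewrite [RHS]surjective_pairing A2.
  have B0 : (B (al, 0)).1 = 0 by rewrite alE AB.
  have c1 : (Psi (al * x i, 0)).1 / x i @[i --> U] --> (0 : R).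
    by rewrite -[X in _ --> X]B0; exact: (tangent_slope hB).
  have c2 : `|al|^-1 * ((Psi (al * x i, 0)).1 / x i) @[i --> U] --> (0 : R).
    rewrite -[X in _ --> X](mulr0 `|al|^-1).
    by apply: cvgM => //; exact: cvg_cst.
  apply: cvg_trans c2; apply: near_eq_cvg; near=> i.
  have -> : Num.sg al * (`|al| * x i) = al * x i by rewrite mulrA mulr_sg_norm.
  by rewrite invfM mulrCA.
have sg1 : `|Num.sg al| = 1 by rewrite normr_sg al0.
have [m [a [m0 dE a0 gE _]]] := swapped_height_is_power beta_gt1 hG hF (bilip_germ_sym bg) pullF
  x0' sg1 gt slope.
by exists m, a, t.
Unshelve. all: by end_near. Qed.

Lemma swapped_vertical_zero (s t0 : R) : `|s| = 1 -> root (height s F) t0 ->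
  (A (s, 0)).1 = 0 -> forall y, eval2 F (0, y) = 0.
Proof.
move=> s1 ft Xs; have slope : (Phi (s * x i, 0)).1 / x i @[i --> U] --> (0 : R).
  by rewrite -[X in _ --> X]Xs; exact: (tangent_slope hA).
have [m [a [m0 dE a0 fE _]]] := swapped_height_is_power beta_gt1 hF hG bg pullG x0 s1 ft slope.
exact: power_height_vertical_zero beta_gt1 hF s1 m0 dE fE.
Qed.

(** Both heights are multiples of powers of linear polynomials, with the same
    exponent because d = m (beta + 1) determines m. *)
Lemma swapped_equiv (s s' t0 : R) : `|s| = 1 -> root (height s F) t0 ->
  (A (s, 0)).1 = 0 -> (A (0, s')).1 != 0 -> (A (0, s')).2 = 0 ->
  lipschitz_equiv (height s F) (height (Num.sg (A (0, s')).1) G).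
Proof.
move=> s1 ft Xs Y1 Y2.
have slope : (Phi (s * x i, 0)).1 / x i @[i --> U] --> (0 : R).
  by rewrite -[X in _ --> X]Xs; exact: (tangent_slope hA).
have [m [a [m0 dE a0 fE sgn]]] := swapped_height_is_power beta_gt1 hF hG bg pullG x0 s1 ft slope.
have F0 := swapped_vertical_zero s1 ft Xs.
have [m' [c [u0 [m0' dE' c0 gE]]]] := vertical_to_power F0 Y1 Y2.
have mm : m' = m.
  have b1 : b + 1 != 0 by rewrite gt_eqF // addr_gt0 // exponent_gt0.
  move: dE'; rewrite dE => /(mulIf b1)/eqP; rewrite eqr_nat => /eqP.
  by [].
rewrite mm in gE; rewrite fE gE; apply: powers_lipschitz_equiv => // me.
have [e e1 eP] := sgn me.
by apply: sign_at_axis hG _ me gE eP; rewrite normr_sg Y1.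
Qed.

Lemma straight_equiv (s t0 : R) : `|s| = 1 -> root (height s F) t0 ->
  (A (s, 0)).1 != 0 -> lipschitz_equiv (height s F) (height (Num.sg (A (s, 0)).1) G).
Proof.
move=> s1 ft Xs.
exact: (heights_lipschitz_equiv beta_gt1 hF hG bg pullG x0 s1 ft Xs (tangent_slope hA (s:=s))).
Qed.

(** When a horizontal half-line becomes vertical, all four coordinate half-lines
    are tangent to the zero set of F and go to distinct half-axes.  Hence some
    vertical one becomes horizontal, on the side that the other horizontal one
    leaves free. *)
Lemma heights_matching (t1 t2 : R) :
  root (height 1 F) t1 -> root (height (-1) F) t2 -> exists s e : R,
  [/\ `|s| = 1, `|e| = 1, lipschitz_equiv (height s F) (height e G) &
      lipschitz_equiv (height (- s) F) (height (- e) G)].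
Proof.
move=> r1 r2.
have rt (s : R) : `|s| = 1 -> exists t, root (height s F) t.
  by case/unit_sign => ->; [exists t1|exists t2].
have Xray (s : R) : `|s| = 1 -> cross_ray A (s, 0).
  by move=> /rt[t ft]; exact: (root_cross_ray beta_gt1 hF hG bg pullG x0 hA ft).
have neq0 u : u != 0 -> cross_ray A u ->
    ((A u).1 = 0 /\ (A u).2 != 0) \/ ((A u).1 != 0 /\ (A u).2 = 0).
  move=> uN0 Xu; have AuN0 : A u != 0 by apply: contra_neq uN0 => Au0; rewrite -[u]AB Au0 -A0 AB.
  have := Xu 1 ltr01; rewrite scale1r => -[E|E]; [left|right]; split=> //;
    by apply: contra_neq AuN0 => E'; rewrite [A u]surjective_pairing E E'.
have iA := can_inj AB.
have sN0 (s : R) : `|s| = 1 -> s != 0 by move=> s1; rewrite -normr_gt0 s1.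
have Xneq0 (s : R) : `|s| = 1 -> (s, 0) != 0 :> R * R.
  by move=> /sN0; apply: contra_neq => -[].
have Yneq0 (s : R) : `|s| = 1 -> (0, s) != 0 :> R * R.
  by move=> /sN0; apply: contra_neq => -[].
have oppN (s k : R) : `|s| = 1 -> 0 < k -> s <> k * - s.
  move=> s1 k0 sE; have : `|k + 1| * `|s| = 0.
    by rewrite -normrM mulrDl mul1r {2}sE mulrN subrr normr0.
  by rewrite s1 mulr1 => /eqP; rewrite normr_eq0 gt_eqF // addr_gt0.
have ncXX (s : R) : `|s| = 1 -> not_codirectional (s, 0) (- s, 0).
  move=> s1 k k0; have s1' : `|- s| = 1 by rewrite normrN.
  split=> -[] /= sE _; first exact: (oppN s k).
  by apply: (oppN (- s) k); rewrite ?opprK.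
have ncYY (s : R) : `|s| = 1 -> not_codirectional (0, s) (0, - s).
  move=> s1 k k0; have s1' : `|- s| = 1 by rewrite normrN.
  split=> -[] /= _ sE; first exact: (oppN s k).
  by apply: (oppN (- s) k); rewrite ?opprK.
have ncXY (s s' : R) : `|s| = 1 -> `|s'| = 1 -> not_codirectional (s, 0) (0, s').
  move=> s1 s1' k k0; split=> -[] /=.
    by rewrite scaler0 => sE _; have := sN0 s s1; rewrite sE eqxx.
  by rewrite scaler0 => _ sE; have := sN0 s' s1'; rewrite sE eqxx.
(* At most two directions fit on the same axis. *)
have no_three (p q r : R) : p != 0 -> q != 0 -> r != 0 ->
    p * q <= 0 -> p * r <= 0 -> q * r <= 0 -> False.
  move=> p0 q0 r0 /(sg_opposite p0 q0) pq /(sg_opposite p0 r0) pr /(sg_opposite q0 r0).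
  rewrite pr pq opprK => /eqP; rewrite eq_sym -subr_eq0 opprK -mulr2n mulrn_eq0 /=.
  by rewrite sgr_eq0 (negbTE p0).
have swap (s : R) : `|s| = 1 -> (A (s, 0)).1 = 0 -> exists s e : R,
    [/\ `|s| = 1, `|e| = 1, lipschitz_equiv (height s F) (height e G) &
        lipschitz_equiv (height (- s) F) (height (- e) G)].
  move=> s1 Xs; have s1' : `|- s| = 1 by rewrite normrN.
  have n11 : `|-1 : R| = 1 by rewrite normrN normr1.
  have [t ft] := rt s s1; have [t' ft'] := rt (- s) s1'.
  have F0 := swapped_vertical_zero s1 ft Xs.
  have Yray (e : R) : cross_ray A (0, e).
    exact: (vertical_cross_ray beta_gt1 hG bg pullG x0 hA e F0).
  have Xs2 : (A (s, 0)).2 != 0.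
    by case: (neq0 _ (Xneq0 s s1) (Xray s s1)) => -[]; rewrite ?Xs ?eqxx.
  have [_ XX'] := rays_no_collision lA iA A0 (Xray s s1) (Xray _ s1') (ncXX s s1).
  have XY (e : R) : `|e| = 1 -> (A (s, 0)).2 * (A (0, e)).2 <= 0.
    by move=> e1; case: (rays_no_collision lA iA A0 (Xray s s1) (Yray e) (ncXY _ _ s1 e1)).
  have XY' (e : R) : `|e| = 1 -> (A (- s, 0)).1 * (A (0, e)).1 <= 0 /\
      (A (- s, 0)).2 * (A (0, e)).2 <= 0.
    by move=> e1; exact: (rays_no_collision lA iA A0 (Xray _ s1') (Yray e) (ncXY _ _ s1' e1)).
  have [YY1 YY2] := rays_no_collision lA iA A0 (Yray 1) (Yray (-1)) (ncYY 1 (normr1 _)).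
  have [[X1 X2]|[X1 X2]] := neq0 _ (Xneq0 _ s1') (Xray _ s1').
  - have Y12 (e : R) : `|e| = 1 -> (A (0, e)).1 != 0 /\ (A (0, e)).2 = 0.
      move=> e1; case: (neq0 _ (Yneq0 e e1) (Yray e)) => -[Y1 Y2] //; exfalso.
      exact: no_three Xs2 X2 Y2 XX' (XY e e1) (XY' e e1).2.
    have [Y1 Y2] := Y12 1 (normr1 _); have [Z1 Z2] := Y12 (-1) n11.
    exists s, (Num.sg (A (0, 1)).1); split=> //; first by rewrite normr_sg Y1.
      exact: swapped_equiv s1 ft Xs Y1 Y2.
    by rewrite -(sg_opposite Y1 Z1 YY1); exact: swapped_equiv s1' ft' X1 Z1 Z2.
  - have [e [e1 Y1 Y2]] : exists e : R, [/\ `|e| = 1, (A (0, e)).1 != 0 & (A (0, e)).2 = 0].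
      have [[Y1 Y2]|[Y1 Y2]] := neq0 _ (Yneq0 1 (normr1 _)) (Yray 1); last first.
        by exists 1; rewrite normr1.
      have [[Z1 Z2]|[Z1 Z2]] := neq0 _ (Yneq0 (-1) n11) (Yray (-1)); last by exists (-1).
      by case: (no_three _ _ _ Xs2 Y2 Z2 (XY 1 (normr1 _)) (XY (-1) n11) YY2).
    exists s, (Num.sg (A (0, e)).1); split=> //; first by rewrite normr_sg Y1.
      exact: swapped_equiv s1 ft Xs Y1 Y2.
    rewrite (sg_opposite X1 Y1 (XY' e e1).1) opprK.
    exact: straight_equiv s1' ft' X1.
have n1 : `|1 : R| = 1 by exact: normr1.
have n11 : `|-1 : R| = 1 by rewrite normrN normr1.
have [X1|X1] := eqVneq (A (1, 0)).1 0; first exact: swap n1 X1.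
have [X2|X2] := eqVneq (A (-1, 0)).1 0; first exact: swap n11 X2.
exists 1, (Num.sg (A (1, 0)).1); split=> //; first by rewrite normr_sg X1.
  exact: straight_equiv n1 r1 X1.
have [XX _] := rays_no_collision lA iA A0 (Xray 1 n1) (Xray _ n11) (ncXX 1 n1).
by rewrite -(sg_opposite X1 X2 XX); exact: straight_equiv n11 r2 X2.
Qed.

End Matching.

(** * The theorem *)

Lemma bilip_germ_of_homeo (R : realType) (F G : {poly {poly R}})
    (Phi : R * R -> R * R) :
  sa_bilipschitz_homeo_germ Phi -> germ_pullback F G Phi ->
  exists (Psi : R * R -> R * R) (K rho : R),
    [/\ bilip_germ Phi Psi K rho,
        forall p, `|p| < rho -> eval2 G (Phi p) = eval2 F p &
        forall q, `|q| < rho -> eval2 F (Psi q) = eval2 G q].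
Proof.
move=> [Phi0 [D [E [[oD D0] [oE E0] _ [Psi [DE ED lipPhi lipPsi]]]]]] pull.
have Psi0 : Psi (0, 0) = (0, 0) by rewrite -{1}Phi0 (DE _ D0).2.
have [K1 K10 hK1] := lipschitz_onP lipPhi; have [K2 K20 hK2] := lipschitz_onP lipPsi.
have /nbhs_normP[rD /= rD0 hD] : nbhs ((0, 0) : R * R) D by exact: open_nbhs_nbhs.
have /nbhs_normP[rE /= rE0 hE] : nbhs ((0, 0) : R * R) E by exact: open_nbhs_nbhs.
have /nbhs_normP[rP /= rP0 hP] := pull.
(* The term rP / K2 makes Psi map the ball into the one where G o Phi = F. *)
pose K := Num.max K1 K2; pose rho := Num.min (Num.min rD rE) (Num.min rP (rP / K2)).
have inball (p : R * R) r : `|p| < r -> ball_ Num.norm ((0, 0) : R * R) r p.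
  by move=> pr; rewrite /ball_ /= sub0r normrN.
have rho_gt0 : 0 < rho by rewrite !lt_min rD0 rE0 rP0 divr_gt0.
have inD p : `|p| < rho -> D p by rewrite !lt_min => /andP[/andP[? _] _]; apply/hD/inball.
have inE' p : `|p| < rho -> E p by rewrite !lt_min => /andP[/andP[_ ?] _]; apply/hE/inball.
have lip1 p q : `|p| < rho -> `|q| < rho -> `|Phi p - Phi q| <= K * `|p - q|.
  move=> /inD Dp /inD Dq; rewrite (le_trans (hK1 _ _ Dp Dq)) // ler_wpM2r //.
  by rewrite le_max lexx.
have lip2 p q : `|p| < rho -> `|q| < rho -> `|Psi p - Psi q| <= K * `|p - q|.
  move=> /inE' Ep /inE' Eq; rewrite (le_trans (hK2 _ _ Ep Eq)) // ler_wpM2r //.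
  by rewrite le_max lexx orbT.
exists Psi, K, rho; split.
- split=> //; first by rewrite lt_max K10.
  + by move=> p /inD /DE[].
  + by move=> q /inE' /ED[].
- by move=> p; rewrite !lt_min => /andP[_ /andP[pr _]]; apply/hP/inball.
- move=> q qr; have Eq := inE' q qr; rewrite -{2}(ED _ Eq).2; apply/esym/hP/inball.
  rewrite -[Psi q]subr0 -[X in _ - X]Psi0 (le_lt_trans (hK2 _ _ Eq E0)) //.
  rewrite (subr0 q) mulrC -ltr_pdivlMr //.
  by move: qr; rewrite !lt_min => /andP[_ /andP[_]].
Qed.

Lemma zero_on_side (R : realType) (beta : rat) (d : nat) (F : {poly {poly R}})
    (s : R) (p : R * R) : quasihomogeneous beta d F -> `|s| = 1 ->
  eval2 F p = 0 -> 0 < s * p.1 -> exists t, root (height s F) t.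
Proof.
move=> hF s1 F0 sp; have ss : s * s = 1 by case: (unit_sign s1) => ->; rewrite ?mulrNN mulr1.
exists (p.2 / (s * p.1) `^ ratr beta); move: F0.
have -> : p = (s * (s * p.1), p.2) by rewrite mulrA ss mul1r -surjective_pairing.
rewrite (eval2_height hF) // => /eqP; rewrite mulf_eq0 expf_eq0 (gt_eqF sp) andbF /=.
by rewrite mulrA ss mul1r.
Qed.

Theorem corollary5 (R : realType) (beta : rat) (d : nat)
    (F G : {poly {poly R}})
    (beta_gt1 : 1 < beta) (d_ge1 : (1 <= d)%N)
    (hF : quasihomogeneous beta d F) (hG : quasihomogeneous beta d G)
    (VF_right : zero_set F `&` [set p | 0 < p.1] !=set0)
    (VF_left : zero_set F `&` [set p | p.1 < 0] !=set0) :
  (R_sa_lipschitz_equiv F G ->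
     (lipschitz_equiv (height_right F) (height_right G) /\
      lipschitz_equiv (height_left F) (height_left G)) \/
     (lipschitz_equiv (height_right F) (height_left G) /\
      lipschitz_equiv (height_left F) (height_right G)))
  /\
  (forall Phi : R * R -> R * R,
     sa_bilipschitz_homeo_germ Phi -> germ_pullback F G Phi ->
     (direct_isomorphism beta d Phi ->
        lipschitz_equiv (height_right F) (height_right G) /\
        lipschitz_equiv (height_left F) (height_left G)) /\
     (reverse_isomorphism beta d Phi ->
        lipschitz_equiv (height_right F) (height_left G) /\
        lipschitz_equiv (height_left F) (height_right G))).
Proof.
have n1 : `|1 : R| = 1 by exact: normr1.
have n11 : `|-1 : R| = 1 by rewrite normrN normr1.
have [p [Fp /= p1]] := VF_right; have [q [Fq /= q1]] := VF_left.
have [t1 rt1] : exists t, root (height 1 F) t.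
  by apply: (zero_on_side hF n1 Fp); rewrite mul1r.
have [t2 rt2] : exists t, root (height (-1) F) t.
  by apply: (zero_on_side hF n11 Fq); rewrite mulN1r oppr_gt0.
have [U [UU U0]] := ultraFilterLemma (at_right_proper_filter (0 : R)).
have x0 : (x : R) @[x --> U] --> 0^'+ by move=> A /U0.
split=> [[Phi [bh pull]]|Phi bh pull].
  have [Psi [K [rho [bg pullG pullF]]]] := bilip_germ_of_homeo bh pull.
  have [A [B [hA hB AB BA [A0 lA]]]] := tangent_germ bg x0.
  have [s [e [s1 e1]]] := heights_matching beta_gt1 hF hG bg pullG pullF x0 hA hB AB A0 lA rt1 rt2.
  case: (unit_sign s1) => ->; case: (unit_sign e1) => ->; rewrite ?opprK => E1 E2.
  - by left.
  - by right.
  - by right.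
  - by left.
have [Psi [K [rho [bg pullG pullF]]]] := bilip_germ_of_homeo bh pull.
have right_equiv l : right_slope Phi l -> l != 0 ->
    lipschitz_equiv (height 1 F) (height (Num.sg l) G).
  move=> sl l0; apply: (heights_lipschitz_equiv beta_gt1 hF hG bg pullG x0 n1 rt1 l0).
  apply: (cvg_trans _ (cvg_trans (cvg_app _ U0) sl)).
  by apply: near_eq_cvg; near=> x; rewrite mul1r.
have left_equiv l : left_slope Phi l -> l != 0 ->
    lipschitz_equiv (height (-1) F) (height (- Num.sg l) G).
  move=> sl l0; rewrite -sgrN; have l0' : - l != 0 by rewrite oppr_eq0.
  apply: (heights_lipschitz_equiv beta_gt1 hF hG bg pullG x0 n11 rt2 l0').
  have c1 : (Phi (- x, 0)).1 / - x @[x --> U] --> l.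
    move/cvg_at_leftNP: sl; rewrite oppr0 => sl.
    exact: cvg_trans (cvg_app _ U0) sl.
  have c2 : - ((Phi (- x, 0)).1 / - x) @[x --> U] --> - l by exact: cvgN.
  apply: (cvg_trans _ c2); apply: near_eq_cvg; near=> x.
  by rewrite mulN1r invrN mulrN opprK.
split=> -[_ [l sl l0] [l' sl' l0']].
- have := right_equiv l sl; have := left_equiv l' sl'.
  rewrite !gtr0_sg // gt_eqF // gt_eqF // => H1 H2; split; [exact: H2|exact: H1].
- have := right_equiv l sl; have := left_equiv l' sl'.
  rewrite !ltr0_sg // lt_eqF // lt_eqF // opprK => H1 H2; split; [exact: H2|exact: H1].
Unshelve. all: by end_near. Qed.
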